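(* There is an absolute constant $C>0$ such that the following holds. Let $p$ be a prime and let $\mathcal{G}$ be a multiplicative subgroup of $\mathbb{F}_p^*$. Then for any $\lambda\in\mathbb{F}_p^*$, $$ \left|\mathrm{E}^\times(\mathcal{G}+\lambda)-\frac{|\mathcal{G}|^4}{p}\right|\le C\cdot \begin{cases} p^{1/2}|\mathcal{G}|^{3/2}, & \text{if } |\mathcal{G}|\ge p^{2/3},\\ |\mathcal{G}|^3p^{-1/2}, & \text{if } p^{2/3}>|\mathcal{G}|\ge p^{1/2}\log p,\\ |\mathcal{G}|^2\log|\mathcal{G}|, & \text{if } |\mathcal{G}|<p^{1/2}\log p. \end{cases} $$
   Context: $\mathbb{F}_p$ is the finite field with $p$ elements and $\mathbb{F}_p^*$ its multiplicative group. $\mathcal{G}+\lambda=\{g+\lambda: g\in\mathcal{G}\}$. For a set $\mathcal{U}\subseteq\mathbb{F}_p$, the multiplicative energy $\mathrm{E}^\times(\mathcal{U})$ is the number of solutions to $u_1v_1=u_2v_2$ with $u_1,u_2,v_1,v_2\in\mathcal{U}$. $\log$ is the natural logarithm.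
   Formalization: In the third range the subgroup is assumed nontrivial (|G| > 1): for |G| = 1 and p ≥ 3 the right-hand side is 0 because log|G| = 0, while the left-hand side equals 1 − 1/p > 0. *)

(* Defs.v *)
From HB Require Import structures.
From mathcomp Require Import all_boot all_order all_algebra all_fingroup.

Set Implicit Arguments.
Unset Strict Implicit.
Unset Printing Implicit Defensive.

Import GRing.Theory.
Local Open Scope ring_scope.

(* Quadruples are ordered as (u1, u2, v1, v2). *)
Definition mul_energy (p : nat) (U : {set 'F_p}) : nat :=
  #|[set x : 'F_p * 'F_p * 'F_p * 'F_p |
      let: (u1, u2, v1, v2) := x in
      [&& u1 \in U, u2 \in U, v1 \in U, v2 \in U & u1 * v1 == u2 * v2]]|.

Definition shift_subgroup (p : nat) (G : {group {unit 'F_p}}) (lambda : 'F_p) :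
    {set 'F_p} :=
  [set val g + lambda | g in G].

(* Main.v *)
Require Import Defs.
From HB Require Import structures.
From mathcomp Require Import all_boot all_order all_algebra all_fingroup.
From mathcomp Require Import all_classical all_reals all_analysis.
From mathcomp Require Import zify ring lra.

(** Write t for the order of G, p for the size of the field and mu = t^2 / p for
    the expected size of the fibres below.

    Sorting the solutions of u1 v1 = u2 v2 by the common ratio r = u1 / u2 = v2 / v1
    turns the energy of G + lambda into a sum of squares of the numbers of
    representations of r as a ratio, up to O(t^2) solutions that involve 0.  For
    r <> 0, 1, the substitution u = g1 / ((r - 1) lambda) identifies the pairs
    with g1 + lambda = r (g2 + lambda) with the solutions u of

      u^t = s v^t,  (1 - u)^t = s (1 - v)^t,  v = 1 / (1 - r),  s = (-1 / lambda)^t,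

    so everything is governed by the fibres N(c) of the map
    u |-> (u^t, (1 - u)^t).  Opening the square shows that the error is at most
    twice the sum of (N(c) - mu)^2 N(c / s) over pairs c of t-th powers, up to
    O(t^2 + p) (energy_error_le_variance, ratio_variance_le_weighted).  When
    t^2 < p the term O(p) is too large, and the variance of the ratios is
    estimated directly (ratio_variance_le_rich).

    Two facts on the fibres carry the estimate.
    - Second moment: if u and v lie in the same fibre, then u / v and
      (1 - u) / (1 - v) are in G, and these two ratios determine (u, v) unless both
      are 1; hence the sum of (N(c) - mu)^2 is at most 5 p (fibre_card_variance).
      In particular N(c) <= mu + 3 sqrt p, which gives an error O(p^(3/2) + t^2)
      for every t (energy_error_le_sqrt).
    - Stepanov's method: if 64 t^4 <= p^3, then for every integer A >= max(1, mu) at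
      most t^2 / (8 A^3) pairs c have N(c) >= 128 A (card_rich_pairs).  Summing over A, the
      sum of N(c)^3 over the large fibres is O(t^2 (1 + log t))
      (sum_cube_rich).  The small fibres contribute O(t^2): by the second moment if
      t^2 > p, and through the total number of ratios otherwise.

    Since p^(3/2) = O(t^2) when 64 t^4 > p^3, the second fact and the first give
    together an error O(t^2 (1 + log t)) for all t (energy_error_uniform), which
    is the bound needed in the two ranges with smaller t.  In the range
    t >= p^(2/3), both p^(3/2) and t^2 are at most p^(1/2) t^(3/2)
    (energy_error_large). *)

Set Implicit Arguments.
Unset Strict Implicit.
Unset Printing Implicit Defensive.

Import Order.TTheory GRing.Theory Num.Theory.
Local Open Scope ring_scope.

(** * Zeros of polynomials through the operator X(1-X) d/dX *)

(** This derivation multiplies X^m (1 - X)^n by a polynomial of degree at most 1,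
    whatever m and n are, and outside 0 and 1 its iterates detect the order of
    vanishing as those of the usual derivative do. *)
Definition euler_deriv (F : fieldType) (f : {poly F}) : {poly F} :=
  'X * (1 - 'X) * f^`().

(** The conjugate of euler_deriv by multiplication by X^m (1 - X)^n. *)
Definition twisted_deriv (F : fieldType) (m n : nat) (f : {poly F}) : {poly F} :=
  euler_deriv f + (m%:R *: (1 - 'X) - n%:R *: 'X) * f.

Lemma euler_derivM (F : fieldType) (f g : {poly F}) :
  euler_deriv (f * g) = euler_deriv f * g + f * euler_deriv g.
Proof. by rewrite /euler_deriv derivM; ring. Qed.

Lemma euler_deriv_monomial (F : fieldType) (m n : nat) (f : {poly F}) :
  euler_deriv ('X^m * (1 - 'X) ^+ n * f) = 'X^m * (1 - 'X) ^+ n * twisted_deriv m n f.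
Proof.
have H1 : euler_deriv 'X^m = m%:R *: (1 - 'X) * 'X^m :> {poly F}.
  rewrite /euler_deriv derivXn; case: m => [|m]; first by rewrite mulr0n mulr0 scale0r mul0r.
  by rewrite -pred_Sn exprS -scaler_nat -!mul_polyC; ring.
have H2 : euler_deriv ((1 - 'X) ^+ n) = - (n%:R *: 'X * (1 - 'X) ^+ n) :> {poly F}.
  rewrite /euler_deriv deriv_exp; case: n => [|n].
    by rewrite mulr0n mulr0 scale0r mul0r oppr0.
  rewrite -pred_Sn exprS derivB derivC derivX -mulr_natl -!mul_polyC polyC_natr.
  ring.
rewrite 2!euler_derivM H1 H2 /twisted_deriv.
by rewrite -!mul_polyC; ring.
Qed.

Lemma iter_euler_deriv_monomial (F : fieldType) (m n d : nat) (f : {poly F}) :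
  iter d (@euler_deriv F) ('X^m * (1 - 'X) ^+ n * f)
  = 'X^m * (1 - 'X) ^+ n * iter d (twisted_deriv m n) f.
Proof. by elim: d => //= d ->; rewrite euler_deriv_monomial. Qed.

Lemma euler_derivB (F : fieldType) (f g : {poly F}) :
  euler_deriv (f - g) = euler_deriv f - euler_deriv g.
Proof. by rewrite /euler_deriv derivB mulrBr. Qed.

Lemma euler_derivD (F : fieldType) (f g : {poly F}) :
  euler_deriv (f + g) = euler_deriv f + euler_deriv g.
Proof. by rewrite /euler_deriv derivD mulrDr. Qed.

Lemma iter_euler_deriv_sum (F : fieldType) (I : finType) (f : I -> {poly F}) d :
  iter d (@euler_deriv F) (\sum_i f i) = \sum_i iter d (@euler_deriv F) (f i).
Proof.
have th0 : @euler_deriv F 0 = 0 by rewrite /euler_deriv deriv0 mulr0.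
by elim: d => //= d ->; rewrite (big_morph _ (@euler_derivD F) th0).
Qed.

Lemma iter_twisted_derivB (F : fieldType) m n d (f g : {poly F}) :
  iter d (twisted_deriv m n) (f - g)
  = iter d (twisted_deriv m n) f - iter d (twisted_deriv m n) g.
Proof. by elim: d => //= d ->; rewrite /twisted_deriv euler_derivB; ring. Qed.

(** The degree grows by one per derivation and does not depend on m and n: this is
    what keeps the number of vanishing conditions in Stepanov's method small. *)
Lemma size_iter_twisted_deriv (F : fieldType) m n d (f : {poly F}) :
  (size (iter d (twisted_deriv m n) f) <= size f + d)%N.
Proof.
elim: d => [|d IH] /=; first by rewrite addn0.
set h := iter d _ f in IH *.
have sl (a b : F) : (size (a *: (1 - 'X) - b *: 'X)%R <= 2)%N.
  have -> : a *: (1 - 'X) - b *: 'X = a%:P - (a + b) *: 'X.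
    by rewrite -!mul_polyC polyCD; ring.
  rewrite (leq_trans (size_polyD _ _)) // size_polyN geq_max.
  rewrite (leq_trans (size_polyC_leq1 _)) //=.
  by rewrite (leq_trans (size_scale_leq _ _)) // size_polyX.
rewrite /twisted_deriv (leq_trans (size_polyD _ _)) // geq_max; apply/andP; split.
  rewrite /euler_deriv; have [h0|h0] := eqVneq h 0.
    by rewrite h0 deriv0 mulr0 size_poly0.
  have h1 := size_poly_gt0 h; rewrite h0 in h1.
  rewrite (leq_trans (size_polyMleq _ _)) //.
  have hd := lt_size_deriv h0.
  have hx : (size ('X * (1 - 'X) : {poly F})%R <= 3)%N.
    rewrite (leq_trans (size_polyMleq _ _)) // size_polyX.
    by rewrite -(size_polyN (1 - 'X)) opprB size_XsubC.
  have arith a b c e : (a <= 3 -> b < c -> c <= e -> (a + b).-1 <= e.+1)%N by lia.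
  by rewrite addnS; apply: arith hx hd IH.
rewrite (leq_trans (size_polyMleq _ _)) //.
have arith a b e : (a <= 2 -> b <= e -> (a + b).-1 <= e.+1)%N by lia.
by rewrite addnS; apply: arith (sl _ _) IH.
Qed.

(** Only the term in which every derivation hits the factor X - u survives
    at u. *)
Lemma iter_euler_deriv_XsubC (F : fieldType) (u : F) d (g : {poly F}) :
  (iter d (@euler_deriv F) (('X - u%:P) ^+ d * g)).[u]
  = d`!%:R * (u * (1 - u)) ^+ d * g.[u].
Proof.
elim: d g => [|d IH] g; first by rewrite fact0 !expr0 /= !mul1r.
rewrite iterSr.
have -> : euler_deriv (('X - u%:P) ^+ d.+1 * g) = ('X - u%:P) ^+ d *
    (d.+1%:R *: ('X * (1 - 'X) * g) + ('X - u%:P) * euler_deriv g).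
  rewrite euler_derivM {1}/euler_deriv deriv_exp derivXsubC -pred_Sn -mulr_natl -mul_polyC.
  by rewrite polyC_natr exprS; ring.
rewrite IH hornerD hornerZ (hornerM ('X - _)) hornerXsubC subrr mul0r addr0.
by rewrite !hornerM hornerD hornerN hornerX hornerC factS natrM exprS; ring.
Qed.

(** The order of vanishing can be read on iterates of euler_deriv as long as the
    factorial of the order is invertible, hence the bound by the
    characteristic. *)
Lemma dvd_exp_XsubC_euler_deriv (F : fieldType) p (u : F) D (f : {poly F}) :
  p \in [pchar F] -> u != 0 -> u != 1 -> (D <= p)%N ->
  (forall d, (d < D)%N -> (iter d (@euler_deriv F) f).[u] = 0) ->
  ('X - u%:P) ^+ D %| f.
Proof.
move=> pF u0 u1; elim: D => [|D IH] Dp H; first by rewrite expr0 dvd1p.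
have /dvdpP [g fg] : ('X - u%:P) ^+ D %| f.
  by apply: IH => [|d dD]; [exact: ltnW | apply: H; exact: ltnW].
have : (iter D (@euler_deriv F) f).[u] == 0 by rewrite H.
rewrite fg mulrC iter_euler_deriv_XsubC !mulf_eq0 expf_eq0 mulf_eq0 (negPf u0) subr_eq0.
rewrite [1 == u]eq_sym (negPf u1) andbF orbF -(dvdn_pcharf pF).
rewrite -[(_ %| _)%N]negbK -prime_coprime ?(pcharf_prime pF) //.
have -> /= : coprime p D`!.
  elim: D Dp {IH H fg} => [|D IH] Dp; first by rewrite fact0 coprimen1.
  rewrite factS coprimeMr IH ?(ltnW Dp) // andbT prime_coprime ?(pcharf_prime pF) //.
  by apply/negP => /dvdn_leq -/(_ isT); lia.
rewrite -rootE => /factor_theorem [h ->].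
by rewrite mulrCA dvdp_mull // exprSr.
Qed.

Lemma card_mult_roots (F : finFieldType) (X : {set F}) D (f : {poly F}) :
  f != 0 -> (forall u, u \in X -> ('X - u%:P) ^+ D %| f) ->
  (#|X| * D < size f)%N.
Proof.
move=> f0 H.
have Hd (s : seq F) : uniq s -> {subset s <= X} ->
    \prod_(u <- s) ('X - u%:P) ^+ D %| f.
  elim: s => [|u s IH] /=; first by rewrite big_nil dvd1p.
  case/andP=> us us' sub; rewrite big_cons Gauss_dvdp.
    rewrite H ?sub ?mem_head // IH // => v vs; apply: sub.
    by rewrite inE vs orbT.
  apply: coprimep_expl; rewrite coprimep_sym coprimep_XsubC /root horner_prod.
  rewrite prodf_seq_neq0; apply/allP => v vs /=.
  rewrite !hornerE expf_eq0 negb_and subr_eq0; apply/orP; right.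
  by apply: contraNneq us => ->.
have /dvdp_leq : \prod_(u <- enum X) ('X - u%:P) ^+ D %| f.
  by apply: Hd; [exact: enum_uniq | move=> u; rewrite mem_enum].
move=> /(_ f0); rewrite size_prod_seq; last first.
  by move=> u _; rewrite expf_neq0 // polyXsubC_eq0.
have -> : (\sum_(u <- enum X) size (('X - u%:P) ^+ D : {poly F})%R)%N = (#|X| * D.+1)%N.
  under eq_bigr => u _ do rewrite size_exp_XsubC.
  by rewrite big_const_seq count_predT iter_addn_0 -cardE mulnC.
by rewrite -cardE mulnS -addnS addKn.
Qed.

Lemma natr_eq_pchar (F : fieldType) p i j : p \in [pchar F] ->
  (i < p)%N -> (j < p)%N -> (i%:R == j%:R :> F) = (i == j).
Proof.
move=> pF; wlog ij : i j / (i <= j)%N.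
  move=> W ip jp; case: (leqP i j) => [|/ltnW] h; first exact: W.
  by rewrite eq_sym W // eq_sym.
move=> ip jp; rewrite eq_sym -subr_eq0 -natrB // -(dvdn_pcharf pF).
apply/idP/eqP => [/dvdnP [[|k] E]|->]; last by rewrite subnn.
  by apply/eqP; rewrite eqn_leq ij -subn_eq0 E.
lia.
Qed.

(** A nonzero polynomial with m terms and degree below the characteristic cannot
    vanish to order m at 1: X f' - j f has one term less than f, where j is an
    exponent of f, and loses at most one order of vanishing. *)
Lemma sparse_dvd_eq0 (F : fieldType) p (J : seq nat) (f : {poly F}) :
  p \in [pchar F] -> (size f <= p)%N -> (forall j, f`_j != 0 -> j \in J) ->
  ('X - 1%:P) ^+ size J %| f -> f = 0.
Proof.
move=> pF; elim: J f => [|j J IH] f sf sJ.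
  move=> _; apply/polyP=> j; rewrite coef0; apply/eqP/negPn/negP=> /sJ.
  by rewrite in_nil.
move=> df.
pose g := 'X * f^`() - j%:R *: f.
have cg i : g`_i = (i%:R - j%:R) * f`_i.
  rewrite coefB coefXM coefZ; case: i => [|i] /=; first by rewrite mulrBl mul0r.
  by rewrite coef_deriv mulrBl !mulr_natl.
have /dvdpP [h fh] := df.
have g0 : g = 0.
  apply: IH.
  - apply/leq_sizeP => i pi; rewrite cg.
    by move/leq_sizeP: sf => /(_ i pi) ->; rewrite mulr0.
  - move=> i; rewrite cg mulf_eq0 negb_or => /andP [ij /sJ]; rewrite inE.
    by case: (i =P j) ij => [->|//]; rewrite subrr eqxx.
  - rewrite /g; apply: dvdp_sub; last first.
      by rewrite -mul_polyC dvdp_mull // (dvdp_trans _ df) // dvdp_exp2l /=.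
    apply: dvdp_mull; rewrite fh derivM; apply: dvdp_add.
      by rewrite dvdp_mull // dvdp_exp2l /=.
    by rewrite deriv_exp -mulr_natl; do 3 ?[apply: dvdp_mull].
have fj0 : f`_j != 0 -> f = 0.
  move=> fj; have fi i : i != j -> f`_i = 0.
    move=> ij; apply/eqP/negPn/negP => fi0.
    have := cg i; rewrite g0 coef0 => /esym/eqP; rewrite mulf_eq0 (negPf fi0) orbF.
    have lt_p k : f`_k != 0 -> (k < p)%N.
      by rewrite ltnNge; apply: contra => pk; rewrite nth_default // (leq_trans sf).
    by rewrite subr_eq0 (natr_eq_pchar pF) ?lt_p // (negPf ij).
  have fE : f = f`_j *: 'X^j.
    apply/polyP => i; rewrite coefZ coefXn; case: eqP => [->|/eqP/fi ->].
      by rewrite mulr1.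
    by rewrite mulr0.
  have : root f 1 by rewrite root_factor_theorem (dvdp_trans _ df) // exprS dvdp_mulr.
  by rewrite fE /root hornerZ hornerXn expr1n mulr1 (negPf fj).
have [fj|/fj0 //] := eqVneq f`_j 0.
apply: IH => //; last by rewrite (dvdp_trans _ df) // dvdp_exp2l /=.
by move=> i fi; have := sJ i fi; rewrite inE => /orP [/eqP ij|//]; rewrite ij fj eqxx in fi.
Qed.

(** * Stepanov's method for points with prescribed powers *)

(** Uniqueness of a W-adic expansion: the lowest digit is divisible by W, hence
    zero, and one divides by W. *)
Lemma sum_exp_mul_eq0 (F : fieldType) (W : {poly F}) B (Q : 'I_B -> {poly F}) :
  W != 0 -> (forall c, W %| Q c -> Q c = 0) ->
  \sum_(c < B) W ^+ c * Q c = 0 -> forall c, Q c = 0.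
Proof.
move=> W0; elim: B Q => [|B IH] Q HQ; first by move=> _ [].
rewrite big_ord_recl expr0 mul1r.
have -> : \sum_(i < B) W ^+ lift ord0 i * Q (lift ord0 i)
        = W * \sum_(i < B) W ^+ i * Q (lift ord0 i).
  by rewrite big_distrr /=; apply: eq_bigr => i _; rewrite /bump exprS mulrA.
move=> /eqP E; have Q0 : Q ord0 = 0.
  apply: HQ; move: E; rewrite addr_eq0 => /eqP ->.
  by rewrite -mulrN dvdp_mulr.
move: E; rewrite Q0 add0r mulf_eq0 (negPf W0) /= => /eqP E c.
case: (unliftP ord0 c) => [j|] -> //.
by apply: (IH (fun i => Q (lift ord0 i))) => // i; apply: HQ.
Qed.

Definition digit_poly (F : fieldType) (I : finType) A (l : {ffun 'I_A * I -> F})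
    (z : I) : {poly F} := \sum_(a < A) l (a, z) *: 'X^a.

(** The auxiliary polynomial of Stepanov's method: at the points where X^t and
    (1 - X)^t have given values, it agrees with a polynomial of degree below A. *)
Definition aux_poly (F : fieldType) t A B (l : {ffun 'I_A * ('I_B * 'I_B) -> F}) :=
  \sum_(z : 'I_B * 'I_B) 'X^(t * z.1) * (1 - 'X) ^+ (t * z.2) * digit_poly l z.

(** Grouping by the powers of (1 - X)^t, each digit is a polynomial with at most
    A B <= t terms, which cannot vanish to order t at 1. *)
Lemma aux_poly_inj (F : fieldType) p t A B (l : {ffun 'I_A * ('I_B * 'I_B) -> F}) :
  p \in [pchar F] -> (A * B <= t)%N -> (t * B <= p)%N ->
  aux_poly t l = 0 -> forall z, l z = 0.
Proof.
move=> pF ABt tBp P0.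
pose Q (c : 'I_B) : {poly F} :=
  \sum_(x : 'I_A * 'I_B) l (x.1, (x.2, c)) *: 'X^(t * x.2 + x.1).
have PQ : \sum_(c < B) ((1 - 'X) ^+ t) ^+ c * Q c = 0.
  have E : \sum_(b < B) \sum_(c < B) 'X^(t * b) * (1 - 'X) ^+ (t * c) *
      (\sum_(a < A) l (a, (b, c)) *: 'X^a) = 0.
    by rewrite -[RHS]P0 pair_bigA /=; apply: eq_bigr => -[b c].
  rewrite -[RHS]E [RHS]exchange_big /=.
  apply: eq_bigr => c _; rewrite /Q.
  rewrite -(pair_bigA _ (fun (a : 'I_A) (b : 'I_B) =>
    l (a, (b, c)) *: 'X^(t * b + a))) /= exchange_big /= big_distrr /=.
  apply: eq_bigr => b _; rewrite !big_distrr /=; apply: eq_bigr => a _.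
  by rewrite -exprM exprD -!mul_polyC; set x := _ ^+ (t * c); set y := _ ^+ (t * b); ring.
have AB (x y : 'I_A * 'I_B) : (t * x.2 + x.1 = t * y.2 + y.1)%N -> x = y.
  case: x y => [a b] [a' b'] /= E.
  have At : (A <= t)%N.
    rewrite (leq_trans _ ABt) // leq_pmulr // (leq_ltn_trans _ (ltn_ord b)) //.
  have a1 := leq_trans (ltn_ord a) At; have a2 := leq_trans (ltn_ord a') At.
  have t0 : (0 < t)%N by rewrite (leq_ltn_trans _ a1).
  congr (_, _); apply: val_inj => /=.
    by have /(congr1 (modn^~ t)) := E; rewrite !(mulnC t) !modnMDl !modn_small.
  have /(congr1 (divn^~ t)) := E.
  by rewrite !(mulnC t) !divnMDl // !divn_small // !addn0.
have cQ c j : (Q c)`_j = \sum_(x : 'I_A * 'I_B)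
    l (x.1, (x.2, c)) * (j == t * x.2 + x.1)%N%:R.
  by rewrite coef_sum; apply: eq_bigr => x _; rewrite coefZ coefXn.
have Q0 : forall c, Q c = 0.
  apply: sum_exp_mul_eq0 PQ.
    by rewrite expf_neq0 // -oppr_eq0 opprB polyXsubC_eq0.
  move=> c dQ; pose J := [seq (t * x.2 + x.1)%N | x : 'I_A * 'I_B].
  have sQ j : (Q c)`_j != 0 -> j \in J.
    apply: contraR => jJ; rewrite cQ big1 // => x _.
    case: eqP => [jx|]; last by rewrite mulr0.
    by case/negP: jJ; rewrite jx; apply/fintype.imageP; exists x.
  apply: (@sparse_dvd_eq0 _ p J (Q c) pF _ sQ).
    apply/leq_sizeP => j pj; apply/eqP/negPn/negP => /sQ /fintype.imageP [x _ jx].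
    have [hb ha] := (ltn_ord x.2, ltn_ord x.1).
    move: pj; apply/negP; rewrite -ltnNge jx.
    have At : (A <= t)%N.
      by rewrite (leq_trans _ ABt) // leq_pmulr // (leq_ltn_trans _ hb).
    have tx : (t * x.2.+1 <= t * B)%N by rewrite leq_mul2l hb orbT.
    rewrite (leq_trans _ tBp) // (leq_trans _ tx) // mulnS addnC ltn_add2r.
    exact: leq_trans ha At.
  rewrite (dvdp_trans _ dQ) //.
  have -> : (1 - 'X) ^+ t = (-1) ^+ t *: ('X - 1%:P) ^+ t :> {poly F}.
    by rewrite -mul_polyC polyC_exp polyCN -exprMn; congr (_ ^+ _); ring.
  rewrite dvdpZr ?expf_neq0 ?oppr_eq0 ?oner_eq0 //.
  by rewrite dvdp_exp2l // size_image card_prod !card_ord.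
move=> [a [b c]]; have := cQ c (t * b + a)%N; rewrite Q0 coef0.
rewrite (bigD1 (a, b)) //= eqxx mulr1 big1 ?addr0 // => x xab.
case: eqP => [/esym/(AB x (a, b)) E|]; last by rewrite mulr0.
by rewrite E eqxx in xab.
Qed.

Lemma size_digit_poly (F : fieldType) (I : finType) A (l : {ffun 'I_A * I -> F}) z :
  (size (digit_poly l z) <= A)%N.
Proof.
apply: (leq_trans (size_sum _ _ _)); apply/bigmax_leqP => a _.
by rewrite (leq_trans (size_scale_leq _ _)) // size_polyXn.
Qed.

Lemma size_aux_poly (F : fieldType) t A B (l : {ffun 'I_A * ('I_B * 'I_B) -> F}) :
  (A <= t)%N -> (size (aux_poly t l) <= 2 * t * B)%N.
Proof.
move=> At; apply: (leq_trans (size_sum _ _ _)); apply/bigmax_leqP => z _.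
have sz m n (f : {poly F}) : (size f <= A)%N ->
    (size ('X^m * (1 - 'X) ^+ n * f)%R <= m + n + A)%N.
  move=> sf; have sX : size ((1 - 'X) ^+ n : {poly F})%R = n.+1.
    have -> : (1 - 'X) ^+ n = (-1) ^+ n *: ('X - 1%:P) ^+ n :> {poly F}.
      by rewrite -mul_polyC polyC_exp polyCN -exprMn; congr (_ ^+ _); ring.
    by rewrite size_scale ?expf_neq0 ?oppr_eq0 ?oner_eq0 // size_exp_XsubC.
  apply: (leq_trans (size_polyMleq _ _)).
  have := size_polyMleq 'X^m ((1 - 'X) ^+ n : {poly F}).
  rewrite sX size_polyXn addSn addnS /= => h.
  have arith a b c d : (a <= b.+1 -> c <= d -> (a + c).-1 <= b + d)%N by lia.
  exact: arith h sf.
apply: (leq_trans (sz _ _ _ (size_digit_poly _ _))).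
have h1 : (t * z.1.+1 <= t * B)%N by rewrite leq_mul2l ltn_ord orbT.
have h2 : (t * z.2.+1 <= t * B)%N by rewrite leq_mul2l ltn_ord orbT.
have arith a b c d e : (t + a <= b -> t + c <= b -> d = 2 * b -> e <= t -> a + c + e <= d)%N.
  lia.
by rewrite !mulnS in h1 h2; apply: arith h1 h2 _ At; rewrite mulnA.
Qed.

Definition pow_pair (F : fieldType) t (u : F) : F * F := (u ^+ t, (1 - u) ^+ t).

(** There are A B^2 coefficients, while vanishing to order A at all the points over
    S costs at most #|S| A (2 A) linear conditions: for each pair in S and each of
    the A derivatives, the coefficients of one polynomial of size at most 2 A.
    So some nonzero auxiliary polynomial satisfies all of them, and its degree
    bounds the number of its zeros counted with multiplicity. *)
Lemma stepanov (F : finFieldType) p t A B (S : {set F * F}) :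
  p \in [pchar F] -> (0 < A)%N -> (0 < B)%N -> (A * B <= t)%N -> (t * B <= p)%N ->
  (2 * #|S| * A < B ^ 2)%N -> (forall c, c \in S -> c.1 != 0 /\ c.2 != 0) ->
  (#|pow_pair t @^-1: S| * A <= 2 * t * B)%N.
Proof.
move=> pF A0 B0 ABt tBp SAB S0.
have At : (A <= t)%N by rewrite (leq_trans _ ABt) // leq_pmulr.
have t0 : (0 < t)%N by rewrite (leq_trans A0).
have Ap : (A <= p)%N.
  by rewrite (leq_trans At) // (leq_trans _ tBp) // leq_pmulr.
pose cond (c : F * F) d (l : {ffun 'I_A * ('I_B * 'I_B) -> F}) : {poly F} :=
  \sum_(z : 'I_B * 'I_B) (c.1 ^+ z.1 * c.2 ^+ z.2) *:
     iter d (twisted_deriv (t * z.1) (t * z.2)) (digit_poly l z).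
pose Phi (l : {ffun 'I_A * ('I_B * 'I_B) -> F}) :
    {ffun 'I_#|S| * 'I_A * 'I_(2 * A) -> F} :=
  [ffun y : 'I_#|S| * 'I_A * 'I_(2 * A) => (cond (enum_val y.1.1) y.1.2 l)`_y.2].
(* Pigeonhole: two coefficient families satisfy the same conditions; take their
   difference. *)
have [l lcond [z lz]] : exists2 l,
    (forall c d, c \in S -> (d < A)%N -> cond c d l = 0) & exists z, l z != 0.
  have /injectivePn [l1 [l2 l12 E]] : ~~ injectiveb Phi.
    apply/negP => /injectiveP /leq_card.
    rewrite !card_ffun !card_prod !card_ord leq_exp2l; last exact: card_finNzRing_gt1.
    apply/negP; rewrite -ltnNge.
    have -> : (#|S| * A * (2 * A) = A * (2 * #|S| * A))%N by ring.
    by rewrite ltn_pmul2l // mulnn.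
  exists [ffun z => l1 z - l2 z]; last first.
    have /existsP [z lz] : [exists z, l1 z != l2 z].
      apply: contraNT l12; rewrite negb_exists => /forallP h.
      by apply/eqP/ffunP => z; apply/eqP; rewrite -[_ == _]negbK.
    by exists z; rewrite ffunE subr_eq0.
  move=> c d cS dA; apply/polyP => j; rewrite coef0.
  have -> : cond c d [ffun z => l1 z - l2 z] = cond c d l1 - cond c d l2.
    rewrite /cond -sumrB; apply: eq_bigr => z _.
    rewrite -scalerBr -iter_twisted_derivB; congr (_ *: iter _ _ _).
    rewrite /digit_poly -sumrB; apply: eq_bigr => a _.
    by rewrite ffunE scalerBl.
  case: (ltnP j (2 * A)) => jA.
    have /ffunP /(_ (enum_rank_in cS c, Ordinal dA, Ordinal jA)) := E.
    by rewrite !ffunE /= enum_rankK_in // coefB => ->; rewrite subrr.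
  have sc l : (size (cond c d l) <= 2 * A)%N.
    apply: (leq_trans (size_sum _ _ _)); apply/bigmax_leqP => z _.
    apply: (leq_trans (size_scale_leq _ _)).
    apply: (leq_trans (size_iter_twisted_deriv _ _ _ _)).
    by rewrite mul2n -addnn leq_add ?size_digit_poly // ltnW.
  by rewrite coefB !nth_default ?subrr // (leq_trans (sc _)).
have P0 : aux_poly t l != 0.
  by apply: contraNneq lz => /(aux_poly_inj pF ABt tBp) ->.
apply: leq_trans (ltnW (card_mult_roots (D := A) P0 _)) (size_aux_poly _ At).
move=> u; rewrite inE => uS; have /= [u0 u1] := S0 _ uS.
apply: (dvd_exp_XsubC_euler_deriv pF) => //.
- by apply: contraNneq u0 => ->; rewrite expr0n eqn0Ngt t0.
- by apply: contraNneq u1 => ->; rewrite subrr expr0n eqn0Ngt t0.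
move=> d dA; rewrite /aux_poly iter_euler_deriv_sum horner_sum.
rewrite -[RHS](horner0 u) -[in RHS](lcond _ _ uS dA).
rewrite /cond horner_sum; apply: eq_bigr => y _.
rewrite iter_euler_deriv_monomial hornerZ !hornerM hornerXn horner_exp hornerD hornerN.
by rewrite hornerX hornerC /= !exprM.
Qed.

(** * Pairs with large fibres *)

Definition nz_pair (F : fieldType) (c : F * F) := (c.1 != 0) && (c.2 != 0).

Definition fibre_card (F : finFieldType) t (c : F * F) :=
  #|[set u : F | pow_pair t u == c]|.

(** Pairs with a zero entry are excluded because their fibres lie in {0, 1}, where
    euler_deriv does not see multiplicities. *)
Definition rich_pairs (F : finFieldType) t m : {set F * F} :=
  [set c | nz_pair c & (m <= fibre_card t c)%N].

Lemma card_preim_pow_pair (F : finFieldType) t (S : {set F * F}) :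
  #|pow_pair t @^-1: S| = (\sum_(c in S) fibre_card t c)%N.
Proof.
rewrite -sum1_card (partition_big (pow_pair t) [in S]) /=; last first.
  by move=> u; rewrite inE.
apply: eq_bigr => c cS; rewrite sum1_card; apply: eq_card => u.
by rewrite unfold_in /= !inE; case: eqP => [->|]; rewrite ?cS ?andbF.
Qed.

Lemma card_nth_roots (F : finFieldType) t (a : F) : (0 < t)%N ->
  (#|[set u : F | u ^+ t == a]| <= t)%N.
Proof.
move=> t0; set X := [set _ | _].
have s0 : size ('X^t - a%:P : {poly F}) = t.+1 by rewrite size_XnsubC.
have p0 : 'X^t - a%:P != 0 :> {poly F} by rewrite -size_poly_gt0 s0.
rewrite cardE -ltnS -s0; apply: max_poly_roots => //; last exact: enum_uniq.
apply/allP => u; rewrite mem_enum inE => /eqP ua.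
by rewrite /root !hornerE ua subrr.
Qed.

Lemma fibre_card_le (F : finFieldType) t (c : F * F) : (0 < t)%N ->
  (fibre_card t c <= t)%N.
Proof.
move=> t0; apply: leq_trans (card_nth_roots c.1 t0); apply: subset_leq_card.
by apply/fintype.subsetP => u; rewrite !inE => /eqP <-.
Qed.

(** The choice B = t / A balances the hypotheses of stepanov. *)
Lemma stepanov_cubic (F : finFieldType) p t A (S : {set F * F}) :
  p \in [pchar F] -> (0 < A)%N -> (8 * #|S| * A ^ 3 <= t ^ 2)%N ->
  (t ^ 2 <= p * A)%N -> (forall c, c \in S -> nz_pair c) ->
  (#|pow_pair t @^-1: S| * A ^ 2 <= 2 * t ^ 2)%N.
Proof.
move=> pF A0 SA tpA S0.
have [->|] := eqVneq S finset.set0; first by rewrite finset.preimset0 cards0.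
rewrite -card_gt0 => k0; move: SA; set k := #|S| in k0 * => SA.
have At : (A <= t)%N.
  rewrite leqNgt; apply/negP => tA; move: SA; apply/negP; rewrite -ltnNge.
  have : (t ^ 2 < A ^ 2)%N by rewrite ltn_sqr.
  move/leq_trans; apply; have -> : (8 * k * A ^ 3 = 8 * k * A * A ^ 2)%N by ring.
  by rewrite leq_pmull // !muln_gt0 k0 A0.
pose B := (t %/ A)%N.
have B0 : (0 < B)%N by rewrite divn_gt0.
have ABt : (A * B <= t)%N by rewrite mulnC leq_trunc_div.
have t2AB : (t < 2 * (A * B))%N.
  have := ltn_ceil t A0; rewrite -/B mulSn mulnC => h.
  by apply: (leq_trans h); rewrite mul2n -addnn leq_add2r leq_pmulr.
have tBp : (t * B <= p)%N.
  rewrite -(leq_pmul2r A0) (leq_trans _ tpA) // -mulnA leq_mul2l mulnC ABt.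
  by rewrite orbT.
have kAB : (2 * k * A < B ^ 2)%N.
  rewrite -(@ltn_pmul2r (4 * A ^ 2)) ?muln_gt0 ?expn_gt0 ?A0 //.
  have -> : (2 * k * A * (4 * A ^ 2) = 8 * k * A ^ 3)%N by ring.
  apply: leq_ltn_trans SA _.
  have -> : (B ^ 2 * (4 * A ^ 2) = (2 * (A * B)) ^ 2)%N by ring.
  by rewrite ltn_sqr.
have := stepanov pF A0 B0 ABt tBp kAB; rewrite -/k => /(_ _) h.
have {}h : (#|pow_pair t @^-1: S| * A <= 2 * t * B)%N.
  by apply: h => c /S0 /andP.
rewrite expnSr mulnA expn1 (leq_trans (leq_mul h (leqnn A))) //.
have -> : (2 * t * B * A = 2 * t * (A * B))%N by ring.
by rewrite -mulnA -mulnn !leq_mul2l ABt !orbT.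
Qed.

Lemma subset_of_card (T : finType) (S : {set T}) k : (k <= #|S|)%N ->
  exists2 S' : {set T}, S' \subset S & #|S'| = k.
Proof.
move=> kS; exists [set x in take k (enum S)].
  by apply/fintype.subsetP => x; rewrite inE => /mem_take; rewrite mem_enum.
rewrite cardsE; have /card_uniqP -> : uniq (take k (enum S)).
  by rewrite take_uniq // enum_uniq.
by rewrite size_takel // -cardE.
Qed.

(** If there were more rich pairs, applying Stepanov's bound to as many of them as
    it allows would contradict their richness. *)
Lemma card_rich_pairs_small (F : finFieldType) p t A :
  p \in [pchar F] -> (0 < t)%N -> (0 < A)%N -> (8 * A ^ 3 <= t ^ 2)%N ->
  (t ^ 2 <= p * A)%N ->
  (8 * #|rich_pairs F t (128 * A)| * A ^ 3 <= t ^ 2)%N.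
Proof.
move=> pF t0 A0 At tpA; rewrite leqNgt; apply/negP => big.
have A3 : (0 < A ^ 3)%N by rewrite expn_gt0 A0.
have A8 : (0 < 8 * A ^ 3)%N by rewrite muln_gt0.
(* The largest number of pairs to which stepanov_cubic applies. *)
pose k := (t ^ 2 %/ (8 * A ^ 3))%N.
have k0 : (0 < k)%N by rewrite divn_gt0.
have k1 : (k * (8 * A ^ 3) <= t ^ 2)%N := leq_trunc_div _ _.
have k2 : (t ^ 2 < k.+1 * (8 * A ^ 3))%N := ltn_ceil _ A8.
have kR : (k <= #|rich_pairs F t (128 * A)|)%N.
  by rewrite ltnW // ltn_divLR // mulnCA mulnA.
have [S SR Sk] := subset_of_card kR.
have : (#|pow_pair t @^-1: S| * A ^ 2 <= 2 * t ^ 2)%N.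
  apply: (stepanov_cubic pF A0) => //; first by rewrite Sk mulnAC mulnC.
  by move=> c /(fintype.subsetP SR); rewrite inE => /andP [].
apply/negP; rewrite -ltnNge card_preim_pow_pair.
have : (k * (128 * A) <= \sum_(c in S) fibre_card t c)%N.
  rewrite -Sk -sum_nat_const; apply: leq_sum => c /(fintype.subsetP SR).
  by rewrite inE => /andP [].
set X := \sum_(c in S) _; move=> hX.
apply: (@leq_trans (k * (128 * A) * A ^ 2)); last by rewrite leq_mul2r hX orbT.
have -> : (k * (128 * A) * A ^ 2 = 128 * (k * A ^ 3))%N by ring.
have : (0 < t ^ 2)%N by rewrite expn_gt0 t0.
move: k1 k2; rewrite mulnCA [X in (_ < X)%N]mulnCA.
have : (k.+1 * A ^ 3 <= 2 * (k * A ^ 3))%N.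
  by rewrite mulnA leq_mul2r; apply/orP; right; lia.
set a := (k.+1 * _)%N; set b := (k * _)%N; set c := (t ^ 2)%N; lia.
Qed.

(** The largest a with 8 a^3 <= t^2; maximality costs a factor 8. *)
Lemma exists_max_cubic t A : (8 <= t ^ 2)%N -> (t ^ 2 < 8 * A ^ 3)%N ->
  exists a, [/\ (0 < a)%N, (a < A)%N, (8 * a ^ 3 <= t ^ 2)%N &
    (t ^ 2 < 64 * a ^ 3)%N].
Proof.
move=> t8; elim: A => [|A IH] h; first by move: h; rewrite exp0n.
have [hA|hA] := leqP (8 * A ^ 3) (t ^ 2); last first.
  by have [a [a0 aA h1 h2]] := IH hA; exists a; split => //; rewrite ltnW // ltnS.
have A0 : (0 < A)%N.
  by case: A {IH hA} h => // h; move: (leq_ltn_trans t8 h).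
exists A; split => //; apply: leq_trans h _.
have -> : (64 * A ^ 3 = 8 * (2 * A) ^ 3)%N by ring.
by rewrite leq_mul2l leq_exp2r //; lia.
Qed.

(** Stepanov's bound for a single fibre: N(c) = O(t^(2/3)). *)
Lemma fibre_card_cubic (F : finFieldType) p t A (c : F * F) :
  p \in [pchar F] -> (0 < t)%N -> (0 < A)%N -> (64 * t ^ 4 <= p ^ 3)%N ->
  nz_pair c -> (128 * A <= fibre_card t c)%N -> (8 * A ^ 3 <= t ^ 2)%N.
Proof.
move=> pF t0 A0 tp cnz hc; rewrite leqNgt; apply/negP => big.
have tA := leq_trans hc (fibre_card_le c t0).
have t8 : (8 <= t ^ 2)%N.
  have : (128 <= t)%N by rewrite (leq_trans _ tA) // leq_pmulr.
  by move=> h; rewrite (@leq_trans (128 ^ 2)) // leq_sqr.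
have [a [a0 aA h1 h2]] := exists_max_cubic t8 big.
have tpa : (t ^ 2 <= p * a)%N.
  rewrite -(@leq_exp2r _ _ 3) // expnMn -(@leq_pmul2l 64) //.
  rewrite mulnCA; apply: (@leq_trans (p ^ 3 * t ^ 2)).
    have -> : (64 * (t ^ 2) ^ 3 = (64 * t ^ 4) * t ^ 2)%N by ring.
    by rewrite leq_mul2r tp orbT.
  by rewrite leq_mul2l ltnW ?orbT.
have : (#|pow_pair t @^-1: [set c]| * a ^ 2 <= 2 * t ^ 2)%N.
  apply: (stepanov_cubic pF a0) => //; first by rewrite cards1 muln1.
  by move=> d /set1P ->.
apply/negP; rewrite -ltnNge card_preim_pow_pair big_set1.
apply: (@leq_trans (128 * a * a ^ 2)).
  by rewrite -mulnA -expnS; lia.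
by rewrite leq_mul2r (leq_trans _ hc) ?orbT // leq_mul2l ltnW.
Qed.

(** For large A there is no rich pair at all, by the bound for a single fibre. *)
Lemma card_rich_pairs (F : finFieldType) p t A :
  p \in [pchar F] -> (0 < t)%N -> (0 < A)%N -> (64 * t ^ 4 <= p ^ 3)%N ->
  (t ^ 2 <= p * A)%N -> (8 * #|rich_pairs F t (128 * A)| * A ^ 3 <= t ^ 2)%N.
Proof.
move=> pF t0 A0 tp tpA.
have [->|] := finset.set_0Vmem (rich_pairs F t (128 * A)); first by rewrite cards0.
move=> [c]; rewrite inE => /andP [cnz hc].
exact/(card_rich_pairs_small pF)/tpA/(fibre_card_cubic pF t0 A0 tp cnz hc).
Qed.

Lemma cube_le_sum h : (h ^ 3 <= \sum_(i < h) 3 * i.+1 ^ 2)%N.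
Proof.
elim: h => [|h IH]; first by rewrite exp0n.
rewrite big_ord_recr /= (leq_trans _ (leq_add IH (leqnn _))) //.
nia.
Qed.

(** Layer-cake summation: a cube is a sum of squares 3 i^2, and at level i the
    count of rich pairs leaves O(t^2 / i).  Levels below A are counted at
    level A, which is why the maximum appears. *)
Lemma sum_cube_rich (F : finFieldType) p t A (R : realFieldType) :
  p \in [pchar F] -> (0 < t)%N -> (0 < A)%N -> (64 * t ^ 4 <= p ^ 3)%N ->
  (t ^ 2 <= p * A)%N ->
  (\sum_(c in rich_pairs F t (128 * A)) fibre_card t c ^ 3)%N%:R
    <= 256 ^+ 3 * t%:R ^+ 2 * \sum_(i < t) i.+1%:R^-1 :> R.
Proof.
move=> pF t0 A0 tp tpA.
have T1 : (\sum_(c in rich_pairs F t (128 * A)) fibre_card t c ^ 3 <=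
    256 ^ 3 * \sum_(i < t) 3 * i.+1 ^ 2 * #|rich_pairs F t (128 * maxn i.+1 A)|)%N.
  under [X in (_ <= _ * X)%N]eq_bigr => i _ do rewrite -sum1_card big_distrr /=.
  rewrite (exchange_big_dep [in rich_pairs F t (128 * A)]) /=; last first.
    move=> i c _; rewrite !inE => /andP [-> /=]; apply: leq_trans.
    by rewrite leq_mul2l leq_maxr.
  rewrite big_distrr /=; apply: leq_sum => c; rewrite inE => /andP [cnz hc].
  (* c is counted at all the levels up to h, and N(c) <= 256 h since h > 0. *)
  pose h := (fibre_card t c %/ 128)%N.
  have hA : (A <= h)%N by rewrite leq_divRL // mulnC.
  have h128 : (h * 128 <= fibre_card t c)%N := leq_trunc_div _ _.
  have ht : (h <= t)%N.
    by rewrite (leq_trans _ (fibre_card_le c t0)) // (leq_trans _ h128) // leq_pmulr.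
  have h256 : (fibre_card t c <= 256 * h)%N.
    have := @ltn_ceil (fibre_card t c) 128 isT; rewrite -/h; lia.
  apply: (@leq_trans ((256 * h) ^ 3)); first by rewrite leq_exp2r.
  rewrite expnMn leq_mul2l (leq_trans (cube_le_sum h)) //.
  rewrite (big_ord_widen t (fun i => 3 * i.+1 ^ 2)%N ht).
  rewrite [X in (X <= _)%N]big_mkcond [X in (_ <= X)%N]big_mkcond /=.
  apply: leq_sum => i _; case: ifP => // ih; rewrite muln1.
  by rewrite inE cnz (leq_trans _ h128) // mulnC leq_mul2r geq_max ih hA orbT.
apply: le_trans (_ : (256 ^ 3 *
  \sum_(i < t) 3 * i.+1 ^ 2 * #|rich_pairs F t (128 * maxn i.+1 A)|)%N%:R <= _).
  by rewrite ler_nat.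
rewrite natrM natrX -mulrA; apply: ler_wpM2l.
  by apply: exprn_ge0; apply: ler0n.
rewrite raddf_sum mulr_sumr /=.
apply: ler_sum => i _; set m := maxn _ _.
have im : (i.+1 <= m)%N := leq_maxl _ _.
have Am : (A <= m)%N := leq_maxr _ _.
have m0 : (0 < m)%N by rewrite (leq_trans A0).
have tpm : (t ^ 2 <= p * m)%N by rewrite (leq_trans tpA) // leq_mul2l Am orbT.
have := card_rich_pairs pF t0 m0 tp tpm; set n := #|_| => hn.
rewrite ler_pdivlMr ?ltr0n // -natrX -natrM ler_nat.
apply: leq_trans hn; rewrite -mulnA mulnAC -mulnA mulnC -mulnA.
have : (i.+1 ^ 3 <= m ^ 3)%N by rewrite leq_exp2r.
set x := (m ^ 3)%N; rewrite expnS; set y := (i.+1 ^ 2)%N => h.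
have : (i.+1 * y * n <= x * n)%N by rewrite leq_mul2r h orbT.
nia.
Qed.

(** * The variance of the fibres *)

Lemma sum_sqr_card_fibre (T U : finType) (A : {set T}) (D : {set U}) (f : T -> U) :
  (forall x, x \in A -> f x \in D) ->
  (\sum_(c in D) #|[set x in A | f x == c]| ^ 2)%N
  = #|[set z : T * T | [&& z.1 \in A, z.2 \in A & f z.1 == f z.2]]|.
Proof.
move=> fD; rewrite -sum1_card (partition_big (fun z => f z.1) [in D]) /=; last first.
  by move=> z; rewrite inE => /andP [/fD].
apply: eq_bigr => c cD; rewrite -mulnn -cardsX -sum1_card; apply: eq_bigl => -[x y].
rewrite !inE /=; case: (x \in A) => //=; case: (y \in A); rewrite ?andbF //=.
by apply/andP/andP => [] [/eqP -> /eqP ->]; rewrite !eqxx.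
Qed.

Lemma sum_card_fibre (T U : finType) (A : {set T}) (D : {set U}) (f : T -> U) :
  (forall x, x \in A -> f x \in D) ->
  (\sum_(c in D) #|[set x in A | f x == c]|)%N = #|A|.
Proof.
move=> fD; rewrite -sum1_card (partition_big f [in D]) //=.
by apply: eq_bigr => c cD; rewrite sum1_card; apply: eq_card => x; rewrite inE.
Qed.

Definition not01 (F : finFieldType) : {set F} := [set u : F | (u != 0) && (u != 1)].

Definition powers (F : finFieldType) t : {set F} := [set x ^+ t | x in [set~ (0 : F)]].

Definition power_pairs (F : finFieldType) t : {set F * F} :=
  finset.setX (powers F t) (powers F t).

Lemma card_not01 (F : finFieldType) : #|not01 F| = (#|F| - 2)%N.
Proof.
have -> : not01 F = ~: [set 0; 1] by apply/finset.setP => u; rewrite !inE negb_or.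
by rewrite cardsCs finset.setCK cards2 eq_sym oner_eq0.
Qed.

Lemma mem_powers (F : finFieldType) t (x : F) : (0 < t)%N ->
  (x ^+ t \in powers F t) = (x != 0).
Proof.
move=> t0; apply/finset.imsetP/idP => [[y]|x0]; last by exists x; rewrite // !inE.
rewrite !inE => y0 E; apply: contraNneq y0 => x0.
by move: E; rewrite x0 expr0n eqn0Ngt t0 /= => /esym/eqP; rewrite expf_eq0 => /andP [].
Qed.

Lemma powers_neq0 (F : finFieldType) t (x : F) : x \in powers F t -> x != 0.
Proof. by case/finset.imsetP => y; rewrite !inE => y0 ->; rewrite expf_neq0. Qed.

Lemma pow_pair_powers (F : finFieldType) t (u : F) : (0 < t)%N ->
  (pow_pair t u \in power_pairs F t) = (u \in not01 F).
Proof.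
move=> t0; rewrite !inE !mem_powers // subr_eq0 [1 == u]eq_sym //.
Qed.

Lemma fibre_cardE (F : finFieldType) t (c : F * F) : (0 < t)%N ->
  c \in power_pairs F t ->
  fibre_card t c = #|[set u in not01 F | pow_pair t u == c]|.
Proof.
move=> t0 cI; apply: eq_card => u; rewrite !inE; case: eqP => [E|]; last by rewrite andbF.
by rewrite andbT; move: cI; rewrite -E pow_pair_powers // inE => ->.
Qed.

Lemma sum_fibre_card (F : finFieldType) t : (0 < t)%N ->
  (\sum_(c in power_pairs F t) fibre_card t c)%N = (#|F| - 2)%N.
Proof.
move=> t0; rewrite -card_not01 -(@sum_card_fibre _ _ _
  (power_pairs F t) (pow_pair t)); last first.
  by move=> u; rewrite pow_pair_powers.
by apply: eq_bigr => c cI; apply: fibre_cardE.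
Qed.

Definition unity_roots (F : finFieldType) t : {set F} := [set u : F | u ^+ t == 1].

(** A pair (u, v) with equal images gives the two t-th roots of unity
    g = u / v and h = (1 - u) / (1 - v), and v (g - h) = 1 - h: every (g, h) comes
    from at most one pair, except (1, 1), which comes from the diagonal. *)
Lemma sum_fibre_card_sqr (F : finFieldType) t : (0 < t)%N ->
  (\sum_(c in power_pairs F t) fibre_card t c ^ 2
    <= #|F| + #|unity_roots F t| ^ 2)%N.
Proof.
move=> t0; set H := unity_roots F t.
under eq_bigr => c cI do rewrite (fibre_cardE t0 cI).
rewrite sum_sqr_card_fibre; last by move=> u; rewrite pow_pair_powers.
set Z := finset _.
pose f (z : F * F) := (z.1 / z.2, (1 - z.1) / (1 - z.2)).
have nz z : z \in Z -> [/\ z.2 != 0 & 1 - z.2 != 0].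
  by rewrite !inE => /and3P [_ /andP [h1 h2] _]; rewrite subr_eq0 [1 == _]eq_sym.
have fH z : z \in Z -> f z \in finset.setX H H.
  move=> zZ; have [h1 h2] := nz z zZ; move: zZ.
  rewrite !inE => /and3P [_ _ /eqP [E1 E2]].
  by rewrite !expr_div_n E1 E2 !divff ?expf_neq0 ?eqxx.
rewrite -(sum_card_fibre fH).
have LE : (\sum_(c in finset.setX H H) (if c == (1%R, 1%R) then #|F| else 0)
    + \sum_(c in finset.setX H H) 1 <= #|F| + #|H| ^ 2)%N.
  rewrite leq_add //; last by rewrite sum1_card cardsX mulnn.
  rewrite -big_mkcondr /=.
  rewrite (eq_bigl (pred1 (1, 1))) ?big_pred1_eq // => c /=.
  case: eqP => [->|]; rewrite ?andbF // andbT !inE /= expr1n eqxx //.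
apply: leq_trans LE; rewrite -big_split /=; apply: leq_sum => c _; case: eqP => [->|/eqP c1].
  rewrite (leq_trans _ (leq_addr _ _)) //.
  rewrite -(card_imset _ (fun (x y : F) (e : (x, x) = (y, y)) => congr1 fst e)).
  apply: subset_leq_card; apply/fintype.subsetP => z; rewrite inE => /andP [zZ /eqP [E _]].
  have [h1 _] := nz z zZ; apply/finset.imsetP; exists z.1 => //.
  by rewrite [LHS]surjective_pairing; congr (_, _); rewrite -[RHS](divfK h1) E mul1r.
rewrite add0n; apply/card_le1_eqP => z z'; rewrite finset.in_set => h;
  rewrite finset.in_set => h'.
have E0 x : (x \in Z) && (f x == c) ->
    [/\ x.1 = c.1 * x.2 & x.2 * (c.1 - c.2) = 1 - c.2].
  case/andP => xZ /eqP <-; have [h1 h2] := nz x xZ; rewrite /f /=.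
  by split; field; rewrite ?h1 ?h2.
have c12 x : (x \in Z) && (f x == c) -> c.1 - c.2 != 0.
  move=> hx; have [E1 E2] := E0 x hx; apply: contraNneq c1 => e; move: E2.
  rewrite e mulr0 => /eqP; rewrite eq_sym subr_eq0 => /eqP c2.
  by move/eqP: e; rewrite -c2 subr_eq0 => /eqP e; rewrite [c]surjective_pairing e -c2.
have [E1 E2] := E0 z h; have [E1' E2'] := E0 z' h'.
have e2 : z.2 = z'.2 by apply: (mulIf (c12 z h)); rewrite E2 E2'.
by rewrite [z]surjective_pairing [z']surjective_pairing E1 E1' e2.
Qed.

Lemma card_powers (F : finFieldType) t : (0 < t)%N ->
  (#|powers F t| * #|unity_roots F t| <= #|F|.-1)%N.
Proof.
move=> t0; have <- : #|[set~ (0 : F)]| = #|F|.-1 by rewrite cardsC1.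
rewrite -(@sum_card_fibre _ _ [set~ 0] (powers F t) (fun x => x ^+ t)); last first.
  by move=> x; rewrite !inE mem_powers.
rewrite -sum_nat_const; apply: leq_sum => c /finset.imsetP [x]; rewrite !inE => x0 ->.
rewrite -(card_imset _ (mulfI x0)); apply: subset_leq_card.
apply/fintype.subsetP => y /finset.imsetP [z]; rewrite !inE => /eqP z1 ->.
rewrite exprMn z1 mulr1 eqxx andbT mulf_neq0 //.
by apply: contraTneq (oner_neq0 F) => z0; rewrite -z1 z0 expr0n eqn0Ngt t0 eqxx.
Qed.

(** There are at most ((q - 1) / t)^2 pairs of t-th powers, where q is the size of
    the field, so the second moment q + t^2, the cross term -2 t^2 and the square
    of the mean, at most t^2, cancel up to O(q). *)
Lemma fibre_card_variance (F : finFieldType) t (R : realFieldType) : (0 < t)%N ->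
  #|unity_roots F t| = t ->
  \sum_(c in power_pairs F t)
    ((fibre_card t c)%:R - t%:R ^+ 2 / #|F|%:R) ^+ 2 <= 5 * #|F|%:R :> R.
Proof.
move=> t0 Ht; set I := power_pairs F t; set q : R := #|F|%:R.
set mu := _ / q.
have q2 : (1 < #|F|)%N := card_finNzRing_gt1 F.
have q0 : 0 < q by rewrite ltr0n ltnW.
have -> : \sum_(c in I) ((fibre_card t c)%:R - mu) ^+ 2 =
    (\sum_(c in I) fibre_card t c ^ 2)%N%:R - 2 * mu * (\sum_(c in I) fibre_card t c)%N%:R
    + #|I|%:R * mu ^+ 2.
  rewrite !natr_sum mulr_sumr -sumrB -[#|I|]sum1_card natr_sum mulr_suml -big_split /=.
  by apply: eq_bigr => c _; rewrite natrX; ring.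
rewrite sum_fibre_card // natrB // -/q.
have h1 := sum_fibre_card_sqr F t0; rewrite Ht -/I in h1.
have {}h1 : (\sum_(c in I) fibre_card t c ^ 2)%N%:R <= q + t%:R ^+ 2 :> R.
  by rewrite -natrX -natrD ler_nat.
have h2 : #|I|%:R * mu ^+ 2 <= t%:R ^+ 2.
  have h : #|powers F t|%:R * t%:R <= q.
    rewrite -natrM ler_nat -[X in (_ * X)%N]Ht (leq_trans (card_powers F t0)) //.
    exact: leq_pred.
  rewrite /I /power_pairs cardsX natrM /mu; set a := #|powers F t|%:R in h *.
  have -> : a * a * (t%:R ^+ 2 / q) ^+ 2 = (a * t%:R / q) ^+ 2 * t%:R ^+ 2.
    by field; rewrite gt_eqF.
  rewrite ler_piMl ?sqr_ge0 // expr_le1 // ?ler_pdivrMr ?mul1r //.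
  by rewrite divr_ge0 ?mulr_ge0 // ltW.
have tq : (t <= #|F|)%N by rewrite -[X in (X <= _)%N]Ht max_card.
have h3 : mu <= q.
  rewrite /mu ler_pdivrMr // -expr2 ler_sqr ?nnegrE ?ler0n // ler_nat //.
have h4 : mu * q = t%:R ^+ 2 by rewrite /mu divfK ?gt_eqF.
move: h1 h2; set x := _%:R; set y := _ * mu ^+ 2 => h1 h2.
have -> : x - 2 * mu * (q - 2) + y = x + y - 2 * (mu * q) + 4 * mu by ring.
by rewrite h4; lra.
Qed.

(** * The energy as a sum over ratios *)

(** Over an arbitrary finite field; mul_energy is the case of a prime field. *)
Definition energy (F : finFieldType) (U : {set F}) : nat :=
  #|[set x : F * F * F * F |
      let: (u1, u2, v1, v2) := x in
      [&& u1 \in U, u2 \in U, v1 \in U, v2 \in U & u1 * v1 == u2 * v2]]|.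

Definition ratio_card (F : finFieldType) (U : {set F}) (r : F) : nat :=
  #|[set z in finset.setX U U | z.1 / z.2 == r]|.

Lemma energy_sum_ratio (F : finFieldType) (U : {set F}) : 0 \notin U ->
  energy U = (\sum_(r in [set~ 0%R]) ratio_card U r ^ 2)%N.
Proof.
move=> U0; have nz x : x \in U -> x != 0 by apply: contraTneq => ->.
rewrite sum_sqr_card_fibre; last first.
  by move=> z; rewrite !inE => /andP [/nz h1 /nz h2]; rewrite mulf_neq0 ?invr_neq0.
pose f (x : F * F * F * F) := ((x.1.1.1, x.1.1.2), (x.2, x.1.2)).
have fbij : bijective f.
  by exists (fun z => (z.1.1, z.1.2, z.2.2, z.2.1)) => [[[[a b] c] d]|[[a b] [c d]]].
rewrite -(on_card_preimset (onW_bij _ fbij)); apply: eq_card => -[[[a b] c] d].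
rewrite !inE /=; case aU: (a \in U) => //=; case bU: (b \in U) => //=.
case dU: (d \in U); rewrite ?andbF //=; case cU: (c \in U) => //=.
by rewrite eqr_div ?nz // (mulrC b).
Qed.

Lemma sum_ratio_card (F : finFieldType) (U : {set F}) : 0 \notin U ->
  (\sum_(r in [set~ 0%R]) ratio_card U r)%N = (#|U| ^ 2)%N.
Proof.
move=> U0; have nz x : x \in U -> x != 0 by apply: contraTneq => ->.
rewrite sum_card_fibre ?cardsX ?mulnn // => z.
by rewrite !inE => /andP [/nz h1 /nz h2]; rewrite mulf_neq0 ?invr_neq0.
Qed.

Lemma ratio_card1 (F : finFieldType) (U : {set F}) : 0 \notin U ->
  ratio_card U 1 = #|U|.
Proof.
move=> U0; have inj : injective (fun x : F => (x, x)) by move=> x y [].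
rewrite -(card_imset _ inj); apply: eq_card => -[x y]; rewrite !inE /=.
apply/andP/finset.imsetP => [[/andP [xU yU] /eqP e]|[z zU [-> ->]]].
  have y0 : y != 0 by apply: contraTneq yU => ->.
  by exists y; rewrite // -[x](divfK y0) e mul1r.
by rewrite zU divff //; apply: contraTneq zU => ->.
Qed.

(** A solution with a zero entry has both products zero, and each of the two
    products can vanish in at most 2 #|U| ways. *)
Lemma energyD0 (F : finFieldType) (U : {set F}) :
  (energy (U :\ 0%R) <= energy U <= energy (U :\ 0%R) + 4 * #|U| ^ 2)%N.
Proof.
apply/andP; split.
  apply: subset_leq_card; apply/fintype.subsetP => -[[[a b] c] d]; rewrite !inE.
  by case/and5P => /andP [_ ->] /andP [_ ->] /andP [_ ->] /andP [_ ->] ->.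
pose Z : {set F * F} := [set z | [&& z.1 \in U, z.2 \in U & z.1 * z.2 == 0]].
have cZ : (#|Z| <= 2 * #|U|)%N.
  apply: (@leq_trans #|finset.setX [set 0] U :|: finset.setX U [set 0]|).
    apply: subset_leq_card; apply/fintype.subsetP => -[x y]; rewrite !inE /= mulf_eq0.
    by case/and3P => -> ->; rewrite andbT.
  rewrite (leq_trans (leq_card_setU _ _)) // !cardsX cards1 mul1n muln1.
  by rewrite addnn mul2n.
pose f (x : F * F * F * F) := ((x.1.1.1, x.1.2), (x.1.1.2, x.2)).
have finj : injective f by move=> [[[a b] c] d] [[[a' b'] c'] d'] [-> -> -> ->].
rewrite /energy; set E := finset _; set E' := finset _.
have EE : E \subset E' :|: f @^-1: finset.setX Z Z.
  apply/fintype.subsetP => -[[[a b] c] d]; rewrite !inE /=.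
  case/and5P => -> -> -> -> /eqP e; rewrite e eqxx !andbT /=.
  have := e; have [->|a0] := eqVneq a 0; first by rewrite mul0r => <-; rewrite eqxx orbT.
  have [->|c0] := eqVneq c 0; first by rewrite mulr0 => <-; rewrite eqxx orbT.
  move=> /esym/eqP; rewrite -subr_eq0 => h.
  have : b * d != 0 by rewrite -e mulf_neq0.
  by rewrite mulf_eq0 negb_or => /andP [-> ->].
rewrite (leq_trans (subset_leq_card EE)) // (leq_trans (leq_card_setU _ _)) //.
rewrite leq_add2l; apply: (@leq_trans #|finset.setX Z Z|).
  rewrite -(card_imset _ finj); apply: subset_leq_card.
  by apply/fintype.subsetP => z /finset.imsetP [x]; rewrite inE => h ->.
by rewrite cardsX (leq_trans (leq_mul cZ cZ)) // mulnACA mulnn.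
Qed.

Definition shifted_roots (F : finFieldType) t (l : F) : {set F} :=
  [set x | (x - l) ^+ t == 1].

Lemma card_shifted_roots (F : finFieldType) t (l : F) :
  #|shifted_roots t l| = #|unity_roots F t|.
Proof.
rewrite -(card_imset _ (addrI (- l))); apply: eq_card => x; rewrite !inE.
apply/finset.imsetP/idP => [[y]|x1]; first by rewrite !inE addrC => h ->.
by exists (l + x); rewrite ?inE ?addKr // addrC addKr.
Qed.

Definition scale_pair (F : fieldType) (s : F) (c : F * F) := (s * c.1, s * c.2).

(** The affine map y |-> (r y - l) / ((r - 1) l) identifies the y such that y and
    r y both lie in the shifted group with the fibre; the two counts differ by one
    exactly when y = 0 is one of them. *)
Lemma ratio_card_fibre (F : finFieldType) t (l r : F) :
  l != 0 -> r != 0 -> r != 1 ->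
  (ratio_card (shifted_roots t l :\ 0%R) r
    <= fibre_card t (scale_pair ((- l^-1) ^+ t) (pow_pair t (1 - r)^-1))
    <= (ratio_card (shifted_roots t l :\ 0%R) r).+1)%N.
Proof.
move=> l0 r0 r1; set n := fibre_card _ _.
have r1' : 1 - r != 0 by rewrite subr_eq0 eq_sym.
pose Y := [set y in shifted_roots t l | r * y \in shifted_roots t l].
have -> : n = #|Y|.
  pose f (y : F) := (r * y - l) * (- l^-1) * (1 - r)^-1.
  have fbij : bijective f.
    exists (fun u => (u * (1 - r) * - l + l) / r) => y; rewrite /f; field;
    by rewrite ?l0 ?r0 ?r1' ?oppr_eq0.
  rewrite /n /fibre_card -(on_card_preimset (onW_bij _ fbij)).
  apply: eq_card => y; rewrite !inE /pow_pair /scale_pair xpair_eqE /=.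
  have -> : 1 - f y = (y - l) * ((- l^-1) * (1 - (1 - r)^-1)).
    by rewrite /f; field; rewrite l0 r1'.
  rewrite /f -mulrA !(exprMn t).
  have nz : (- l^-1) ^+ t * (1 - r)^-1 ^+ t != 0.
    by rewrite mulf_neq0 ?expf_neq0 ?oppr_eq0 ?invr_neq0.
  have nz2 : (- l^-1) ^+ t * (1 - (1 - r)^-1) ^+ t != 0.
    rewrite mulf_neq0 ?expf_neq0 ?oppr_eq0 ?invr_neq0 //.
    have -> : 1 - (1 - r)^-1 = - r / (1 - r) by field.
    by rewrite mulf_neq0 ?oppr_eq0 ?invr_neq0.
  rewrite -[X in _ * _ == X]mul1r (inj_eq (mulIf nz)).
  rewrite -[X in _ && (_ == X)]mul1r (inj_eq (mulIf nz2)).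
  by rewrite andbC.
have -> : ratio_card (shifted_roots t l :\ 0%R) r = #|Y :\ 0|.
  have inj : injective (fun y : F => (r * y, y)) by move=> x y [].
  rewrite -(card_imset _ inj); apply: eq_card => -[x y]; rewrite !inE /=.
  apply/andP/finset.imsetP => [[/andP [/andP [x0 xU] /andP [y0 yU]] /eqP e]|[z zU [-> ->]]].
    exists y; last by rewrite -[x](divfK y0) e.
    by rewrite !inE y0 yU -e divfK.
  move: zU; rewrite !inE => /and3P [z0 -> ->].
  by rewrite mulfK // eqxx mulf_neq0 // z0.
rewrite (cardsD1 0 Y) leq_addl /=.
by case: (0 \in Y); rewrite ?add1n ?add0n.
Qed.

(** * The energy error as a variance of ratios *)

Definition ratio_variance (F : finFieldType) t (l : F) (R : realFieldType) : R :=
  \sum_(r in not01 F)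
    ((ratio_card (shifted_roots t l :\ 0) r)%:R - t%:R ^+ 2 / #|F|%:R) ^+ 2.

Lemma card_shifted_rootsD0 (F : finFieldType) t (l : F) :
  #|unity_roots F t| = t ->
  (#|shifted_roots t l :\ 0%R| <= t <= #|shifted_roots t l :\ 0%R|.+1)%N.
Proof.
move=> Ht; rewrite -{2 3}Ht -(card_shifted_roots t l) (cardsD1 0 (shifted_roots t l)).
by rewrite leq_addl /=; case: (0 \in _); rewrite ?add1n ?add0n.
Qed.

Lemma sum_ratio_card_not01 (F : finFieldType) (U : {set F}) : 0 \notin U ->
  (\sum_(r in not01 F) ratio_card U r + #|U| = #|U| ^ 2)%N.
Proof.
move=> U0; rewrite -(sum_ratio_card U0) [RHS](bigD1 1) ?inE ?oner_neq0 //=.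
rewrite ratio_card1 // addnC; congr (_ + _)%N.
by apply: eq_bigl => r; rewrite !inE.
Qed.

Lemma energy_not01 (F : finFieldType) (U : {set F}) : 0 \notin U ->
  (\sum_(r in not01 F) ratio_card U r ^ 2 + #|U| ^ 2 = energy U)%N.
Proof.
move=> U0; rewrite (energy_sum_ratio U0) [RHS](bigD1 1) ?inE ?oner_neq0 //=.
rewrite ratio_card1 // addnC; congr (_ + _)%N.
by apply: eq_bigl => r; rewrite !inE.
Qed.

Lemma card_unity_roots_le (F : finFieldType) t :
  #|unity_roots F t| = t -> (t <= #|F|)%N.
Proof. by move=> <-; apply: max_card. Qed.

(** Expanding the variance, the mean of the number of representations of a ratio is
    mu up to O(t / q), so that the cross terms only change the main term t^4 / q
    by O(t^2). *)
Lemma energy_error_le_variance (F : finFieldType) t (l : F) (R : realFieldType) :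
  (0 < t)%N -> #|unity_roots F t| = t ->
  `|(energy (shifted_roots t l))%:R - t%:R ^+ 4 / #|F|%:R|
    <= ratio_variance t l R + 13 * t%:R ^+ 2.
Proof.
move=> t0 Ht; have tF := card_unity_roots_le Ht.
set U := shifted_roots t l; have /andP [E1 E2] := energyD0 U.
have U0 : 0 \notin U :\ 0 by rewrite !inE eqxx.
have := sum_ratio_card_not01 U0; have := energy_not01 U0.
have /andP [] := card_shifted_rootsD0 l Ht; rewrite -/U.
have cU : #|U| = t by rewrite card_shifted_roots.
move: E1 E2; rewrite /ratio_variance -/U cU; set w := #|U :\ 0%R|.
set E := energy U; set Es := energy _; set rho := ratio_card _.
move=> E1 E2 wt tw H2 H1.
set q : R := #|F|%:R; set mu := _ / q.
have q2 : (1 < #|F|)%N := card_finNzRing_gt1 F.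
have q0 : 0 < q by rewrite ltr0n ltnW.
have V0 : 0 <= \sum_(r in not01 F) ((rho r)%:R - mu) ^+ 2.
  by apply: sumr_ge0 => r _; apply: sqr_ge0.
move: V0; have -> : \sum_(r in not01 F) ((rho r)%:R - mu) ^+ 2 =
    (\sum_(r in not01 F) rho r ^ 2)%N%:R
    - 2 * mu * (\sum_(r in not01 F) rho r)%N%:R + #|not01 F|%:R * mu ^+ 2.
  rewrite !natr_sum mulr_sumr -sumrB -[#|not01 F|]sum1_card natr_sum mulr_suml.
  by rewrite -big_split /=; apply: eq_bigr => c _; rewrite natrX; ring.
rewrite card_not01 natrB // -/q.
have {}H1 : (\sum_(r in not01 F) rho r)%N%:R = w%:R ^+ 2 - w%:R :> R.
  by apply/eqP; rewrite eq_sym subr_eq -natrX -natrD -H1.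
have {}H2 : (\sum_(r in not01 F) rho r ^ 2)%N%:R = Es%:R - w%:R ^+ 2 :> R.
  by apply/eqP; rewrite eq_sym subr_eq -natrX -natrD H2.
rewrite H1 H2.
have {}E1 : Es%:R <= E%:R :> R by rewrite ler_nat.
have {}E2 : E%:R <= Es%:R + 4 * t%:R ^+ 2 :> R.
  by rewrite -natrX -natrM -natrD ler_nat.
have {}wt : w%:R <= t%:R :> R by rewrite ler_nat.
have {}tw : t%:R <= w%:R + 1 :> R by rewrite natr1 ler_nat.
have muq : mu * q = t%:R ^+ 2 by rewrite divfK ?gt_eqF.
have -> : t%:R ^+ 4 / q = mu * t%:R ^+ 2 by rewrite /mu; ring.
have tq : t%:R <= q by rewrite ler_nat.
have t1 : 1 <= t%:R :> R by rewrite ler1n.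
have mut : mu <= t%:R.
  by rewrite /mu ler_pdivrMr // expr2 ler_wpM2l // ler0n.
have mu0 : 0 <= mu by rewrite divr_ge0 ?sqr_ge0 // ltW.
have w0 : 0 <= w%:R :> R by rewrite ler0n.
move: (w%:R) (t%:R) (Es%:R) (E%:R) E1 E2 wt tw muq tq t1 mut w0 => W T es e.
move=> E1 E2 wt tw muq tq t1 mut w0 V0.
have d1 : 0 <= T ^+ 2 - (W ^+ 2 - W) by nra.
have d2 : T ^+ 2 - (W ^+ 2 - W) <= 3 * T by nra.
set d := T ^+ 2 - (W ^+ 2 - W) in d1 d2.
move: V0; have -> : es - W ^+ 2 - 2 * mu * (W ^+ 2 - W) + (q - 2) * mu ^+ 2
   = es - W ^+ 2 - mu * T ^+ 2 + 2 * mu * d - 2 * mu ^+ 2.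
  by rewrite /d -muq; ring.
move=> V0.
have md1 : 0 <= mu * d by rewrite mulr_ge0.
have md2 : mu * d <= 3 * T ^+ 2 by nra.
have mm : mu ^+ 2 <= T ^+ 2 by nra.
have ww : W ^+ 2 <= T ^+ 2 by nra.
have w2 : 0 <= W ^+ 2 by apply: sqr_ge0.
have m2 : 0 <= mu ^+ 2 by apply: sqr_ge0.
rewrite -mulrA in V0 *.
rewrite ler_norml; apply/andP; split; lra.
Qed.

(** * From ratios to fibres *)

Lemma powersM (F : finFieldType) t (s x : F) : (0 < t)%N -> s \in powers F t ->
  (s * x \in powers F t) = (x \in powers F t).
Proof.
move=> t0 /finset.imsetP [y]; rewrite !inE => y0 ->.
apply/finset.imsetP/finset.imsetP => [[z]|[z]]; rewrite !inE => z0.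
  move=> e; exists (y^-1 * z); first by rewrite !inE mulf_neq0 ?invr_neq0.
  by rewrite exprMn -e exprVn mulKf // expf_neq0.
by move=> ->; exists (y * z); rewrite ?inE ?mulf_neq0 ?exprMn.
Qed.

Lemma scale_pair_powers (F : finFieldType) t (s : F) c : (0 < t)%N ->
  s \in powers F t -> (scale_pair s c \in power_pairs F t) = (c \in power_pairs F t).
Proof. by move=> t0 sI; rewrite !inE /= !powersM. Qed.

Lemma scale_pairK (F : fieldType) (s : F) :
  s != 0 -> cancel (scale_pair s) (scale_pair s^-1).
Proof. by move=> s0 [a b]; rewrite /scale_pair /= !mulKf. Qed.

Lemma powersV (F : finFieldType) t (s : F) : s \in powers F t -> s^-1 \in powers F t.
Proof.
case/finset.imsetP => y; rewrite !inE => y0 ->.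
by apply/finset.imsetP; exists y^-1; rewrite ?inE ?invr_neq0 ?exprVn.
Qed.

Lemma sum_scale_pair (F : finFieldType) t (s : F) (V : nmodType) (f : F * F -> V) :
  (0 < t)%N -> s \in powers F t ->
  \sum_(c in power_pairs F t) f (scale_pair s^-1 c) = \sum_(c in power_pairs F t) f c.
Proof.
move=> t0 sI; have s0 := powers_neq0 sI.
rewrite (reindex (scale_pair s)) /=; last first.
  exists (scale_pair s^-1) => c _; first by rewrite scale_pairK.
  by rewrite -[s in scale_pair s _]invrK scale_pairK ?invr_neq0.
by apply: eq_big => c; rewrite ?scale_pair_powers // scale_pairK.
Qed.

(** The pair s (v^t, (1 - v)^t) equals c for at most N(c / s) values of v. *)
Lemma sum_not01_pairs (F : finFieldType) t (s : F) (R : realFieldType)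
    (f : F * F -> R) : (0 < t)%N -> s \in powers F t -> (forall c, 0 <= f c) ->
  \sum_(r in not01 F) f (scale_pair s (pow_pair t (1 - r)^-1))
  <= \sum_(c in power_pairs F t) f c * (fibre_card t (scale_pair s^-1 c))%:R.
Proof.
move=> t0 sI f0; have s0 := powers_neq0 sI.
have i01 (r : F) : r \in not01 F -> (1 - r)^-1 \in not01 F.
  rewrite !inE => /andP [r0 r1]; rewrite invr_eq0 subr_eq0 eq_sym r1 /=.
  by rewrite invr_eq1 -subr_eq0 addrAC subrr sub0r oppr_eq0.
rewrite (partition_big (fun r => scale_pair s (pow_pair t (1 - r)^-1))
  [in power_pairs F t]) /=; last first.
  by move=> r r01; rewrite scale_pair_powers // pow_pair_powers // i01.
apply: ler_sum => c cI.
rewrite (eq_bigr (fun=> f c)) => [|r /andP [_ /eqP -> //]].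
rewrite sumr_const -[in leLHS]mulr_natr ler_wpM2l // ler_nat.
have inj : injective (fun r : F => (1 - r)^-1).
  by move=> x y /invr_inj /addrI /oppr_inj.
rewrite -(card_imset _ inj); apply: subset_leq_card; apply/fintype.subsetP => u.
case/finset.imsetP => r; rewrite unfold_in => /andP [_ /eqP <-] ->.
by rewrite inE scale_pairK.
Qed.

Definition weighted_variance (F : finFieldType) t (s : F) (R : realFieldType) : R :=
  \sum_(c in power_pairs F t) ((fibre_card t c)%:R - t%:R ^+ 2 / #|F|%:R) ^+ 2 *
     (fibre_card t (scale_pair s^-1 c))%:R.

Lemma opp_inv_pow_powers (F : finFieldType) t (l : F) : (0 < t)%N -> l != 0 ->
  (- l^-1) ^+ t \in powers F t.
Proof. by move=> t0 l0; rewrite mem_powers // oppr_eq0 invr_eq0. Qed.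

Lemma ratio_variance_le_weighted (F : finFieldType) t (l : F) (R : realFieldType) :
  (0 < t)%N -> l != 0 ->
  ratio_variance t l R <=
    2 * weighted_variance t ((- l^-1) ^+ t) R + 2 * #|F|%:R.
Proof.
move=> t0 l0; have sI := opp_inv_pow_powers t0 l0.
set s := _ ^+ t in sI *; rewrite /ratio_variance.
set mu := _ / _; set rho := ratio_card _.
pose n r := fibre_card t (scale_pair s (pow_pair t (1 - r)^-1)).
apply: (@le_trans _ _ (\sum_(r in not01 F) (2 * ((n r)%:R - mu) ^+ 2 + 2))).
  apply: ler_sum => r; rewrite inE => /andP [r0 r1].
  have /andP [h1 h2] := ratio_card_fibre t l0 r0 r1.
  have {}h1 : (rho r)%:R <= (n r)%:R :> R by rewrite ler_nat.
  have {}h2 : (n r)%:R <= (rho r)%:R + 1 :> R by rewrite natr1 ler_nat.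
  move: (rho r)%:R (n r)%:R h1 h2 => a b h1 h2.
  have ab : (a - b) ^+ 2 <= 1 by nra.
  have h : 0 <= ((a - b) - (b - mu)) ^+ 2 by apply: sqr_ge0.
  have -> : (a - mu) ^+ 2
    = 2 * (a - b) ^+ 2 + 2 * (b - mu) ^+ 2 - ((a - b) - (b - mu)) ^+ 2 by ring.
  by move: ab h; set x := _ ^+ 2; set y := (b - mu) ^+ 2; set z := _ ^+ 2; lra.
rewrite big_split /= -mulr_sumr lerD //.
  rewrite ler_wpM2l //.
  by apply: (sum_not01_pairs (f := fun c => ((fibre_card t c)%:R - mu) ^+ 2)) => // c;
    apply: sqr_ge0.
by rewrite sumr_const -[leLHS]mulr_natr ler_wpM2l // ler_nat max_card.
Qed.

(** A single term of the variance is at most the whole sum. *)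
Lemma fibre_card_le_sqrt (F : finFieldType) t c (R : rcfType) :
  (0 < t)%N -> #|unity_roots F t| = t -> c \in power_pairs F t ->
  (fibre_card t c)%:R <= t%:R ^+ 2 / #|F|%:R + 3 * Num.sqrt #|F|%:R :> R.
Proof.
move=> t0 Ht cI; set mu := _ / _.
have := fibre_card_variance R t0 Ht; rewrite (bigD1 c) //= -/mu => h.
have {h} : ((fibre_card t c)%:R - mu) ^+ 2 <= 5 * #|F|%:R :> R.
  by apply: le_trans h; rewrite lerDl sumr_ge0 // => d _; apply: sqr_ge0.
have sq : Num.sqrt #|F|%:R ^+ 2 = #|F|%:R :> R by rewrite sqr_sqrtr.
rewrite -[X in 5 * X]sq; have := sqrtr_ge0 (#|F|%:R : R); move: (Num.sqrt #|F|%:R) => x x0 h.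
rewrite -lerBlDl; have x3 : 0 <= 3 * x by rewrite mulr_ge0.
have [y0|y0] := lerP ((fibre_card t c)%:R - mu) 0; first exact: le_trans y0 x3.
rewrite -ler_sqr ?nnegrE ?(ltW y0) //; apply: le_trans h _.
by rewrite exprMn ler_wpM2r ?sqr_ge0 // -natrX ler_nat.
Qed.

Lemma weighted_variance_le_sqrt (F : finFieldType) t (s : F) (R : rcfType) :
  (0 < t)%N -> #|unity_roots F t| = t -> s \in powers F t ->
  weighted_variance t s R <= 5 * t%:R ^+ 2 + 15 * (#|F|%:R * Num.sqrt #|F|%:R).
Proof.
move=> t0 Ht sI; rewrite /weighted_variance; set mu := _ / _.
set q : R := #|F|%:R; have q0 : 0 < q by rewrite ltr0n ltnW ?card_finNzRing_gt1.
apply: (@le_trans _ _ (\sum_(c in power_pairs F t)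
    ((fibre_card t c)%:R - mu) ^+ 2 * (mu + 3 * Num.sqrt q))).
  apply: ler_sum => c cI; rewrite ler_wpM2l ?sqr_ge0 //.
  by apply: fibre_card_le_sqrt => //; rewrite scale_pair_powers ?powersV.
rewrite -mulr_suml; have := fibre_card_variance R t0 Ht; rewrite -/mu -/q => h.
have mu0 : 0 <= mu by rewrite divr_ge0 ?sqr_ge0 // ltW.
have s0 := sqrtr_ge0 q.
apply: (@le_trans _ _ (5 * q * (mu + 3 * Num.sqrt q))).
  by rewrite ler_wpM2r // addr_ge0 // mulr_ge0.
have muq : mu * q = t%:R ^+ 2 by rewrite divfK ?gt_eqF.
by rewrite -muq; lra.
Qed.

Lemma sum_rich_cubes (F : finFieldType) t m (R : realFieldType) :
  \sum_(c in power_pairs F t)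
    (if (m <= fibre_card t c)%N then (fibre_card t c)%:R ^+ 3 else 0)
  <= (\sum_(c in rich_pairs F t m) fibre_card t c ^ 3)%N%:R :> R.
Proof.
rewrite -big_mkcondr /= natr_sum.
rewrite [leLHS]big_mkcond [leRHS]big_mkcond; apply: ler_sum => c _.
rewrite natrX !inE /nz_pair.
case: ifP => [/andP [/andP [/powers_neq0 -> /powers_neq0 ->] ->] //|_].
by case: ifP => _ //; rewrite exprn_ge0.
Qed.

(** * The two bounds for a finite field *)

(** If the weight m = N(c / s) is below 128 A, the variance bounds the term.
    Otherwise the term is at most the cube of the larger of N(c) and m, and this
    one is a large fibre: mu <= A is dominated by it. *)
Lemma weighted_variance_le_rich (F : finFieldType) t A (s : F) (R : realFieldType) :
  (0 < t)%N -> #|unity_roots F t| = t -> s \in powers F t ->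
  (t ^ 2 <= #|F| * A)%N ->
  weighted_variance t s R <= 640 * (A%:R * #|F|%:R) +
    2 * (\sum_(c in rich_pairs F t (128 * A)) fibre_card t c ^ 3)%N%:R.
Proof.
move=> t0 Ht sI tA; rewrite /weighted_variance; set mu := _ / _.
have q0 : 0 < #|F|%:R :> R by rewrite ltr0n ltnW ?card_finNzRing_gt1.
have muA : mu <= A%:R.
  by rewrite /mu ler_pdivrMr // -natrX -natrM ler_nat mulnC.
have mu0 : 0 <= mu by rewrite divr_ge0 ?sqr_ge0 // ltW.
pose g (c : F * F) : R :=
  if (128 * A <= fibre_card t c)%N then (fibre_card t c)%:R ^+ 3 else 0.
have g0 c : 0 <= g c by rewrite /g; case: ifP => // _; rewrite exprn_ge0.
apply: (@le_trans _ _ (\sum_(c in power_pairs F t)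
    (((fibre_card t c)%:R - mu) ^+ 2 * (128 * A%:R) + (g (scale_pair s^-1 c) + g c)))).
  apply: ler_sum => c _; set n := fibre_card t c.
  have := g0 c; have := g0 (scale_pair s^-1 c).
  rewrite /g -/n; set m := fibre_card t _.
  have sq0 : 0 <= (n%:R - mu) ^+ 2 by apply: sqr_ge0.
  have m0 : 0 <= m%:R :> R by [].
  have n0 : 0 <= n%:R :> R by [].
  have A0 : 0 <= A%:R :> R by [].
  case: (leqP (128 * A) m) => [hm|hm]; last first.
    move=> _ h; apply: le_trans (_ : (n%:R - mu) ^+ 2 * (128 * A%:R) <= _).
      by rewrite ler_wpM2l // -natrM ler_nat ltnW.
    by rewrite lerDl add0r.
  move=> m3 h.
  have A128 : 0 <= (n%:R - mu) ^+ 2 * (128 * A%:R) by rewrite mulr_ge0 // mulr_ge0.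
  have {}hm : 128 * A%:R <= m%:R :> R by rewrite -natrM ler_nat.
  have mum : mu <= m%:R.
    by apply: le_trans muA _; apply: le_trans hm; rewrite ler_peMl // ler1n.
  have [nm|mn] := leqP n m.
    have nm' : n%:R <= m%:R :> R by rewrite ler_nat.
    have hsq : (n%:R - mu) ^+ 2 <= m%:R ^+ 2 by nra.
    have : (n%:R - mu) ^+ 2 * m%:R <= m%:R ^+ 3.
      by rewrite [leRHS]exprSr ler_wpM2r.
    by lra.
  have nm' : m%:R <= n%:R :> R by rewrite ler_nat ltnW.
  have -> : (128 * A <= n)%N.
    by rewrite -(ler_nat R) natrM (le_trans hm).
  have hsq : (n%:R - mu) ^+ 2 <= n%:R ^+ 2 by nra.
  have : (n%:R - mu) ^+ 2 * m%:R <= n%:R ^+ 3.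
    by rewrite [leRHS]exprSr ler_pM.
  by lra.
rewrite !big_split /= -mulr_suml sum_scale_pair //.
have := sum_rich_cubes F t (128 * A) R; rewrite -/(g _) => hg.
have {}hg : \sum_(c in power_pairs F t) g c <=
  (\sum_(c in rich_pairs F t (128 * A)) fibre_card t c ^ 3)%N%:R by exact: hg.
have := fibre_card_variance R t0 Ht; rewrite -/mu => hv.
apply: lerD; last by rewrite -[2]/(1 + 1) mulrDl !mul1r lerD.
apply: le_trans (_ : 5 * #|F|%:R * (128 * A%:R) <= _); first by rewrite ler_wpM2r // mulr_ge0.
by lra.
Qed.

(** For t^2 <= q, the variance of the fibres, of order q, would be too large. The
    numbers of representations below 128 are bounded through their sum, at most
    t^2, and the mean mu contributes q mu^2 <= t^2 in total. *)
Lemma ratio_variance_le_rich (F : finFieldType) t (l : F) (R : realFieldType) :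
  (0 < t)%N -> #|unity_roots F t| = t -> l != 0 -> (t ^ 2 <= #|F|)%N ->
  ratio_variance t l R <= 129 * t%:R ^+ 2 +
    2 * (\sum_(c in rich_pairs F t 128) fibre_card t c ^ 3)%N%:R.
Proof.
move=> t0 Ht l0 tF; have sI := opp_inv_pow_powers t0 l0.
set s := _ ^+ t in sI *; rewrite /ratio_variance.
set mu := _ / _; set rho := ratio_card _.
have q0 : 0 < #|F|%:R :> R by rewrite ltr0n ltnW ?card_finNzRing_gt1.
have mu0 : 0 <= mu by rewrite divr_ge0 ?sqr_ge0 // ltW.
pose n r := fibre_card t (scale_pair s (pow_pair t (1 - r)^-1)).
pose f (c : F * F) : R := if (128 <= fibre_card t c)%N then (fibre_card t c)%:R ^+ 2 else 0.
pose g (c : F * F) : R := if (128 <= fibre_card t c)%N then (fibre_card t c)%:R ^+ 3 else 0.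
have g0 c : 0 <= g c by rewrite /g; case: ifP => // _; rewrite exprn_ge0.
apply: (@le_trans _ _ (\sum_(r in not01 F) (128 * (rho r)%:R +
    f (scale_pair s (pow_pair t (1 - r)^-1)) + mu ^+ 2))).
  apply: ler_sum => r; rewrite inE => /andP [r0 r1].
  have /andP [h _] := ratio_card_fibre t l0 r0 r1; rewrite -/rho -/s -/(n r) in h.
  rewrite /f -/(n r).
  have rho0 : 0 <= (rho r)%:R :> R by [].
  apply: (@le_trans _ _ ((rho r)%:R ^+ 2 + mu ^+ 2)); first by nra.
  rewrite lerD2r; case: (leqP 128 (n r)) => hn /=.
    rewrite -[leLHS]add0r; apply: lerD; first by rewrite mulr_ge0.
    by rewrite ler_sqr ?nnegrE // ler_nat.
  rewrite addr0 expr2 ler_wpM2r // ler_nat (leq_trans h) // ltnW //.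
rewrite !big_split /= -mulr_sumr -natr_sum.
have U0 : 0 \notin shifted_roots t l :\ 0 by rewrite !inE eqxx.
have /andP [wt _] := card_shifted_rootsD0 l Ht.
have h1 : (\sum_(r in not01 F) rho r)%N%:R <= t%:R ^+ 2 :> R.
  rewrite -natrX ler_nat (@leq_trans (#|shifted_roots t l :\ 0%R| ^ 2)) ?leq_sqr //.
  by rewrite -(sum_ratio_card_not01 U0) leq_addr.
have h2 : \sum_(r in not01 F) mu ^+ 2 <= t%:R ^+ 2.
  rewrite sumr_const -[leLHS]mulr_natr.
  apply: (@le_trans _ _ (mu ^+ 2 * #|F|%:R)).
    by rewrite ler_wpM2l ?sqr_ge0 // ler_nat max_card.
  have -> : mu ^+ 2 * #|F|%:R = t%:R ^+ 2 * (t%:R ^+ 2 / #|F|%:R).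
    by rewrite /mu; field; rewrite gt_eqF.
  rewrite ler_piMr ?sqr_ge0 // ler_pdivrMr // mul1r -natrX ler_nat //.
have f0 c : 0 <= f c by rewrite /f; case: ifP => // _; rewrite exprn_ge0.
have h3 := sum_not01_pairs t0 sI f0.
have h4 : \sum_(c in power_pairs F t) f c * (fibre_card t (scale_pair s^-1 c))%:R
    <= \sum_(c in power_pairs F t) (g (scale_pair s^-1 c) + g c).
  apply: ler_sum => c _; have := g0 c; have := g0 (scale_pair s^-1 c).
  rewrite /f /g; set a := fibre_card t c; set b := fibre_card t _.
  case: (leqP 128 a) => ha; last by rewrite mul0r addr0.
  have [ab|ba] := leqP b a => ga gb.
    apply: le_trans (_ : a%:R ^+ 3 <= _); last by rewrite lerDr.
    by rewrite [leRHS]exprSr ler_wpM2l ?sqr_ge0 // ler_nat.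
  rewrite (leq_trans ha (ltnW ba)).
  apply: le_trans (_ : b%:R ^+ 3 <= _); last by rewrite lerDl.
  by rewrite [leRHS]exprSr ler_wpM2r // ler_sqr ?nnegrE // ler_nat ltnW.
rewrite big_split /= sum_scale_pair // in h4.
have h5 : \sum_(c in power_pairs F t) g c <=
  (\sum_(c in rich_pairs F t 128) fibre_card t c ^ 3)%N%:R := sum_rich_cubes F t 128 R.
lra.
Qed.

(** For t^2 > q, the threshold A is chosen just above mu, so that A q = O(t^2). *)
Lemma energy_error_le_harmonic (F : finFieldType) t (l : F) (R : realFieldType) :
  (0 < t)%N -> #|unity_roots F t| = t -> l != 0 -> #|F| \in [pchar F] ->
  (64 * t ^ 4 <= #|F| ^ 3)%N ->
  `|(energy (shifted_roots t l))%:R - t%:R ^+ 4 / #|F|%:R|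
    <= (2575 + 4 * 256 ^+ 3) * (t%:R ^+ 2 * \sum_(i < t) i.+1%:R^-1) :> R.
Proof.
move=> t0 Ht l0 pF tp; set H := \sum_(i < t) _.
have H1 : 1 <= H.
  rewrite /H; case: {+}t t0 => // k _; rewrite big_ord_recl /= invr1 lerDl.
  by apply: sumr_ge0 => i _; rewrite invr_ge0.
have t2 : 0 <= t%:R ^+ 2 :> R by rewrite sqr_ge0.
have tH : t%:R ^+ 2 <= t%:R ^+ 2 * H by rewrite ler_peMr.
apply: le_trans (energy_error_le_variance l R t0 Ht) _.
have [u u0 uE] : exists2 u : R, 0 <= u & u = 256 ^+ 3.
  by exists (256 ^+ 3); first by apply: exprn_ge0; apply: ler0n.
rewrite -uE; have K0 : 0 <= u * t%:R ^+ 2 * H.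
  by rewrite -mulrA mulr_ge0 // (le_trans t2).
have [tF|tF] := leqP (t ^ 2) #|F|.
  have h1 := ratio_variance_le_rich R t0 Ht l0 tF.
  have := @sum_cube_rich F #|F| t 1 R pF t0 isT tp; rewrite !muln1 -uE => /(_ tF) h2.
  have E : (2575 + 4 * u) * (t%:R ^+ 2 * H)
      = 2575 * (t%:R ^+ 2 * H) + 4 * (u * t%:R ^+ 2 * H) :> R by ring.
  move: h1 h2 tH K0; rewrite E -/H; set x := t%:R ^+ 2 * H; set y := _ * _ * H.
  by set z := (\sum_(c in _) _)%:R; lra.
(* The least integer above mu; it is at most 2 mu because mu > 1. *)
pose A := (t ^ 2 %/ #|F|).+1.
have F0 : (0 < #|F|)%N by rewrite ltnW ?card_finNzRing_gt1.
have tA : (t ^ 2 <= #|F| * A)%N by rewrite mulnC ltnW // ltn_ceil.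
have AF : (A * #|F| <= 2 * t ^ 2)%N.
  by rewrite /A mulSn mul2n -addnn leq_add ?leq_trunc_div // ltnW.
have {}AF : A%:R * #|F|%:R <= 2 * t%:R ^+ 2 :> R by rewrite -natrX -!natrM ler_nat.
have {}tF : #|F|%:R <= t%:R ^+ 2 :> R by rewrite -natrX ler_nat ltnW.
have h1 := weighted_variance_le_rich R t0 Ht (opp_inv_pow_powers t0 l0) tA.
have := @sum_cube_rich F #|F| t A R pF t0 isT tp tA; rewrite -uE => h2.
have h3 := ratio_variance_le_weighted R t0 l0.
have E : (2575 + 4 * u) * (t%:R ^+ 2 * H)
      = 2575 * (t%:R ^+ 2 * H) + 4 * (u * t%:R ^+ 2 * H) :> R by ring.
move: h1 h2 h3 tH K0; rewrite E -/H; set x := t%:R ^+ 2 * H; set y := _ * _ * H.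
  by set z := (\sum_(c in _) _)%:R; lra.
Qed.

Lemma energy_error_le_sqrt (F : finFieldType) t (l : F) (R : rcfType) :
  (0 < t)%N -> #|unity_roots F t| = t -> l != 0 ->
  `|(energy (shifted_roots t l))%:R - t%:R ^+ 4 / #|F|%:R|
    <= 32 * (#|F|%:R * Num.sqrt #|F|%:R) + 23 * t%:R ^+ 2 :> R.
Proof.
move=> t0 Ht l0.
have h1 := energy_error_le_variance l R t0 Ht.
have h2 := ratio_variance_le_weighted R t0 l0.
have h3 := weighted_variance_le_sqrt R t0 Ht (opp_inv_pow_powers t0 l0).
have h4 : #|F|%:R <= #|F|%:R * Num.sqrt #|F|%:R :> R.
  rewrite ler_peMr // -[leLHS]sqrtr1 ler_sqrt // ?ler1n ?ler0n //.
  by rewrite ltnW ?card_finNzRing_gt1.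
lra.
Qed.

(** * Subgroups of the multiplicative group of a prime field *)

(** A subgroup of order t consists of t roots of X^t - 1, hence of all of them. *)
Lemma unity_roots_subgroup p (G : {group {unit 'F_p}}) :
  unity_roots 'F_p #|G| = [set val g | g in G].
Proof.
apply/esym/eqP; rewrite eqEcard; apply/andP; split.
  apply/fintype.subsetP => x /finset.imsetP [g gG ->]; rewrite inE -FinRing.val_unitX.
  have /dvdnP [k ->] : (#[g]%g %| #|G|)%N by rewrite cardSg // cycle_subG.
  by rewrite mulnC expgM expg_order expg1n.
by rewrite (card_imset _ val_inj) card_nth_roots // cardG_gt0.
Qed.

Lemma card_unity_roots_subgroup p (G : {group {unit 'F_p}}) :
  #|unity_roots 'F_p #|G| | = #|G|.
Proof. by rewrite unity_roots_subgroup (card_imset _ val_inj). Qed.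

Lemma mul_energyE p (G : {group {unit 'F_p}}) (l : 'F_p) :
  mul_energy (shift_subgroup G l) = energy (shifted_roots #|G| l).
Proof.
rewrite /mul_energy -/(energy _); congr energy; apply/finset.setP => x.
rewrite inE; have -> : ((x - l) ^+ #|G| == 1) = (x - l \in unity_roots 'F_p #|G|).
  by rewrite inE.
rewrite unity_roots_subgroup; apply/finset.imsetP/finset.imsetP => [] [g gG e]; exists g => //.
  by rewrite e addrK.
by rewrite -e subrK.
Qed.

(** Induction on n, using 1 / (n + 1) <= ln (n + 1) - ln n. *)
Lemma harmonic_le_ln (R : realType) n : (0 < n)%N ->
  \sum_(i < n) i.+1%:R^-1 <= 1 + ln n%:R :> R.
Proof.
case: n => // n _; elim: n => [|n IH].
  by rewrite big_ord1 invr1 ln1 addr0.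
rewrite big_ord_recr /=; apply: le_trans (_ : 1 + ln n.+1%:R + n.+2%:R^-1 <= _).
  by rewrite lerD2r.
rewrite -addrA lerD2l -lerBrDl -lerN2 opprB.
have n1 : 0 < n.+1%:R :> R by rewrite ltr0n.
have n2 : 0 < n.+2%:R :> R by rewrite ltr0n.
rewrite -ln_div ?posrE //.
have -> : n.+1%:R / n.+2%:R = 1 + - n.+2%:R^-1 :> R.
  by rewrite -(natr1 n.+1) in n2 *; field; rewrite gt_eqF.
apply: le_ln1Dx; rewrite ltrN2 invf_lt1 // ltr1n //.
Qed.

Lemma half_le_ln (R : realType) (x : R) : 2 <= x -> 1 <= 2 * ln x.
Proof.
move=> x2; have x0 : 0 < x by lra.
have h : ln (1 + - 2^-1) <= - 2^-1 :> R by apply: le_ln1Dx; lra.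
have e : 1 + - 2^-1 = 2^-1 :> R by lra.
rewrite e lnV ?posrE // in h.
have : ln 2 <= ln x by rewrite ler_ln ?posrE.
lra.
Qed.

Lemma energy_error_uniform (R : realType) p (G : {group {unit 'F_p}}) (l : 'F_p) :
  prime p -> l != 0 ->
  `|(mul_energy (shift_subgroup G l))%:R - #|G|%:R ^+ 4 / p%:R|
    <= (2575 + 4 * 256 ^+ 3) * (#|G|%:R ^+ 2 * (1 + ln #|G|%:R)) :> R.
Proof.
move=> pp l0; rewrite mul_energyE; set t := #|G|.
have [u u0 uE] : exists2 u : R, 0 <= u & u = 256 ^+ 3.
  by exists (256 ^+ 3); first by apply: exprn_ge0; apply: ler0n.
rewrite -uE.
have t0 : (0 < t)%N := cardG_gt0 G.
have Ht : #|unity_roots 'F_p t| = t := card_unity_roots_subgroup G.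
have cF : #|'F_p| = p := card_Fp pp.
have hl := harmonic_le_ln R t0.
have t2 : 0 <= t%:R ^+ 2 :> R by rewrite sqr_ge0.
(* When 64 t^4 > p^3, the bound in p^(3/2) is already of order t^2. *)
have [tp|tp] := leqP (64 * t ^ 4) (p ^ 3).
  have pF : #|'F_p| \in [pchar 'F_p] by rewrite cF pchar_Fp.
  have := energy_error_le_harmonic R t0 Ht l0 pF; rewrite cF -uE => /(_ tp) h.
  apply: le_trans h _; apply: ler_wpM2l; last by rewrite ler_wpM2l.
  by apply: addr_ge0; [apply: ler0n | apply: mulr_ge0].
have := energy_error_le_sqrt R t0 Ht l0; rewrite cF => h.
apply: le_trans h _.
have ln0 : 0 <= ln t%:R :> R by rewrite ln_ge0 // ler1n.
have h : p%:R * Num.sqrt p%:R <= 8 * t%:R ^+ 2 :> R.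
  rewrite -ler_sqr ?nnegrE ?mulr_ge0 ?sqrtr_ge0 //.
  rewrite exprMn sqr_sqrtr // -exprSr exprMn -exprM.
  have -> : 8 ^+ 2 = 64 :> R by ring.
  by rewrite -!natrX -natrM ler_nat ltnW.
have tl : t%:R ^+ 2 <= t%:R ^+ 2 * (1 + ln t%:R) :> R by rewrite ler_peMr // lerDl.
have x0 := le_trans t2 tl.
have ux : 0 <= u * (t%:R ^+ 2 * (1 + ln t%:R)) by apply: mulr_ge0.
set x := t%:R ^+ 2 * (1 + _) in x0 ux tl *.
have -> : (2575 + 4 * u) * x = 2575 * x + 4 * (u * x) by ring.
by move: ux; set y := u * x; lra.
Qed.

Lemma energy_error_large (R : realType) p (G : {group {unit 'F_p}}) (l : 'F_p) :
  prime p -> l != 0 -> p%:R `^ (2 / 3) <= #|G|%:R :> R ->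
  `|(mul_energy (shift_subgroup G l))%:R - #|G|%:R ^+ 4 / p%:R|
    <= 55 * (p%:R `^ (1 / 2) * #|G|%:R `^ (3 / 2)) :> R.
Proof.
move=> pp l0; rewrite mul_energyE; set t := #|G| => tp.
have t0 : (0 < t)%N := cardG_gt0 G.
have Ht : #|unity_roots 'F_p t| = t := card_unity_roots_subgroup G.
have cF : #|'F_p| = p := card_Fp pp.
have := energy_error_le_sqrt R t0 Ht l0; rewrite cF => h.
apply: le_trans h _.
have tq : t%:R <= p%:R :> R by rewrite ler_nat -cF card_unity_roots_le.
have sq : p%:R `^ (1 / 2) = Num.sqrt p%:R :> R by rewrite mul1r powR12_sqrt.
have h1 : p%:R <= t%:R `^ (3 / 2) :> R.
  have -> : p%:R = (p%:R `^ (2 / 3)) `^ (3 / 2) :> R.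
    by rewrite -powRrM -[LHS]powRr1 //; congr powR; lra.
  by apply: ge0_ler_powR => //; rewrite ?nnegrE ?powR_ge0.
have h2 : t%:R ^+ 2 <= p%:R `^ (1 / 2) * t%:R `^ (3 / 2) :> R.
  have -> : t%:R ^+ 2 = t%:R `^ (1 / 2) * t%:R `^ (3 / 2) :> R.
    rewrite -powRD; last by rewrite pnatr_eq0 -lt0n t0 implybT.
    by rewrite -powR_mulrn //; congr powR; lra.
  by rewrite ler_wpM2r ?powR_ge0 //; apply: ge0_ler_powR => //; rewrite nnegrE.
have h3 : p%:R * Num.sqrt p%:R <= p%:R `^ (1 / 2) * t%:R `^ (3 / 2) :> R.
  by rewrite sq mulrC ler_wpM2l ?sqrtr_ge0.
lra.
Qed.

(* The bounds are stated as three implications because the first and third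
   ranges overlap for small p. In the third one the trivial subgroup has to be
   left out: there ln #|G| = 0, while for p >= 3 the left-hand side is
   1 - 1/p > 0. *)
Theorem corollary4p1 (R : realType) :
  exists2 C : R, 0 < C &
    forall (p : nat) (G : {group {unit 'F_p}}) (lambda : 'F_p),
      prime p -> lambda != 0 ->
      let g : R := #|G|%:R in
      let q : R := p%:R in
      let err : R := `|(mul_energy (shift_subgroup G lambda))%:R - g ^+ 4 / q| in
      [/\ q `^ (2 / 3) <= g ->
            err <= C * (q `^ (1 / 2) * g `^ (3 / 2)),
          g < q `^ (2 / 3) -> q `^ (1 / 2) * ln q <= g ->
            err <= C * (g ^+ 3 * q `^ (- (1 / 2)))
        & g < q `^ (1 / 2) * ln q -> (1 < #|G|)%N ->
            err <= C * (g ^+ 2 * ln g)].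
Proof.
have [K K55 KE] : exists2 K : R, 55 <= K & K = 2575 + 4 * 256 ^+ 3.
  exists (2575 + 4 * 256 ^+ 3) => //.
  have [u u0 <-] : exists2 u : R, 0 <= u & u = 256 ^+ 3.
    by exists (256 ^+ 3); first by apply: exprn_ge0; apply: ler0n.
  lra.
exists (3 * K); first by lra.
move=> p G l pp l0 g q err.
have K0 : 0 <= K by lra.
have g0 : 1 <= g by rewrite ler1n cardG_gt0.
have q2 : 2 <= q by rewrite ler_nat prime_gt1.
have gq : g <= q.
  rewrite /g -(card_unity_roots_subgroup G) ler_nat -[X in (_ <= X)%N](card_Fp pp).
  exact: max_card.
have errU : err <= K * (g ^+ 2 * (1 + ln g)).
  by rewrite KE; apply: energy_error_uniform.
have K3 z : 3 * K * z = K * (3 * z) by ring.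
split.
- move=> qg; apply: le_trans (energy_error_large pp l0 qg) _.
  rewrite ler_wpM2r; [by [] | by rewrite mulr_ge0 ?powR_ge0 | lra].
- move=> _ hg; apply: le_trans errU _; rewrite K3 ler_wpM2l //.
  have s0 : 0 < q `^ (1 / 2) by rewrite powR_gt0; lra.
  rewrite powRN.
  have -> z : 3 * (g ^+ 3 * z) = g ^+ 2 * (3 * (g * z)) by ring.
  rewrite ler_wpM2l ?sqr_ge0 //.
  have h1 : ln q <= g / q `^ (1 / 2) by rewrite ler_pdivlMr // mulrC.
  have h2 : ln g <= ln q by rewrite ler_ln ?posrE //; lra.
  have := half_le_ln q2; lra.
move=> _ G1; apply: le_trans errU _; rewrite K3 ler_wpM2l //.
have g2 : 2 <= g by rewrite ler_nat.
have -> : 3 * (g ^+ 2 * ln g) = g ^+ 2 * (3 * ln g) by ring.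
rewrite ler_wpM2l ?sqr_ge0 //.
by have := half_le_ln g2; lra.
Qed.
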